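(* Let $\mathcal T$ be the rank one extended $W(2,2)$ algebra and let $\Psi(\lambda,\alpha,\beta_1,\mathbf h)$ be the $\mathcal T$-modules defined in the context, for $\lambda\in\mathbb C^*$, $\alpha,\beta_1\in\mathbb C$, $\mathbf h\in\mathcal T_\alpha$. Then: (1) For $\lambda_1,\lambda_2\in\mathbb C^*$, $\alpha_1,\alpha_2,\beta_1,\beta_1'\in\mathbb C$, $\mathbf h\in\mathcal T_{\alpha_1}$, $\mathbf g\in\mathcal T_{\alpha_2}$: $\Psi(\lambda_1,\alpha_1,\beta_1,\mathbf h)\cong\Psi(\lambda_2,\alpha_2,\beta_1',\mathbf g)$ as $\mathcal T$-modules if and only if $\lambda_1=\lambda_2$, $\alpha_1=\alpha_2$, $\beta_1=\beta_1'$ and $\mathbf h=\mathbf g$. (2) $\Psi(\lambda,\alpha,\beta_1,\mathbf h)$ is an irreducible $\mathcal T$-module if and only if $\alpha\neq0$. (3) For a positive integer $m$, $\lambda_i\in\mathbb C^*$, $\alpha_i,\beta_{1,i}\in\mathbb C$, $\mathbf h_i\in\mathcal T_{\alpha_i}$ ($1\le i\le m$) and a restricted $\mathcal T$-module $V$, the $\mathcal T$-module $\bigotimes_{i=1}^m\Psi(\lambda_i,\alpha_i,\beta_{1,i},\mathbf h_i)\otimes V$ is irreducible if and only if $\lambda_1,\dots,\lambda_m$ are pairwise distinct, $\alpha_i\ne0$ for each $i$, and $V$ is an irreducible (restricted) $\mathcal T$-module.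
   Context: The rank one extended $W(2,2)$ algebra $\mathcal T$ is the complex Lie algebra with basis $\{L_m,W_m,H_m\mid m\in\mathbb Z\}$ and brackets $[L_m,L_n]=(n-m)L_{m+n}$, $[L_m,W_n]=(n-m)W_{m+n}$, $[L_m,H_n]=nH_{m+n}$, $[W_m,W_n]=[W_m,H_n]=[H_m,H_n]=0$. A $\mathcal T$-module $V$ is restricted if for every $v\in V$ there is $n\in\mathbb N$ with $L_mv=W_mv=H_mv=0$ for all $m>n$. For $k\in\mathbb N=\{0,1,\dots\}$, $n\in\mathbb Z$, $\alpha\in\mathbb C$ put $h_{n,k;\alpha}(t)=nt^k-n(n-1)\alpha\frac{t^k-\alpha^k}{t-\alpha}\in\mathbb C[t]$. $\mathcal T_\alpha$ (not to be confused with the Lie algebra $\mathcal T$) is the set of all families $\mathbf h=\{h_m(t)\mid m\in\mathbb Z\}$ of polynomials of the form $h_m(t)=\sum_{i\ge0}\xi_ih_{m,i;\alpha}(t)$ with $\xi_i\in\mathbb C$ independent of $m$ and all but finitely many zero. For $\lambda\in\mathbb C^*$, $\alpha,\beta_1\in\mathbb C$, $\mathbf h=\{h_m\}\in\mathcal T_\alpha$, the $\mathcal T$-module $\Psi(\lambda,\alpha,\beta_1,\mathbf h)$ is $\mathbb C[t,s]$ with $L_mf(t,s)=-\lambda^m(s-h_m(-t))f(t,s+m)-m\lambda^m(t+m\alpha)\frac{\partial}{\partial t}f(t,s+m)$, $W_mf(t,s)=\lambda^m(t+m\alpha)f(t,s+m)$, $H_mf(t,s)=\lambda^m\beta_1f(t,s+m)$.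 Tensor products carry the usual Lie algebra tensor product action. *)

(* Defs.v *)
From HB Require Import structures.
From mathcomp Require Import all_boot all_order all_algebra.
From mathcomp Require Import generic_quotient ring_quotient finmap boolp.
From mathcomp Require Import monalg ring.

Set Implicit Arguments.
Unset Strict Implicit.
Unset Printing Implicit Defensive.

Import GRing.Theory.
Local Open Scope ring_scope.
Local Open Scope quotient_scope.

(* [{malg K[X]}] is used only as the vector space with basis [<< a >>], a : X. *)
Section LinearExtension.
Variables (K : fieldType) (X : choiceType) (Z : lmodType K).

Definition linext (f : X -> Z) (x : {malg K[X]}) : Z :=
  \sum_(a <- msupp x) x@_a *: f a.

Lemma linextEw f (d : {fset X}) x : (msupp x `<=` d)%fset ->
  linext f x = \sum_(a <- d) x@_a *: f a.
Proof.
move=> le; rewrite [LHS](big_fset_incl _ le) => //= a _ /mcoeff_outdom ->.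
by rewrite scale0r.
Qed.

Lemma linext_is_linear f : linear (linext f).
Proof.
move=> c x y.
have le1 : (msupp (c *: x + y) `<=` msupp x `|` msupp y)%fset.
  apply: fsubset_trans (msuppD_le _ _) _.
  exact: fsetSU (msuppZ_le _ _).
rewrite (linextEw _ le1) (linextEw _ (fsubsetUl (msupp x) (msupp y))).
rewrite (linextEw _ (fsubsetUr (msupp x) (msupp y))).
rewrite scaler_sumr -big_split /=; apply: eq_bigr => a _.
by rewrite mcoeffD mcoeffZ scalerDl scalerA.
Qed.

HB.instance Definition _ f :=
  GRing.isLinear.Build K {malg K[X]} Z _ (linext f) (linext_is_linear f).

Lemma linextU f a : linext f << a >> = f a.
Proof. by rewrite (linextEw _ msuppU_le) big_seq_fset1 mcoeffUU scale1r. Qed.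

Lemma linext_funD (c : K) f g x :
  linext (fun a => c *: f a + g a) x = c *: linext f x + linext g x.
Proof.
rewrite /linext scaler_sumr -big_split /=; apply: eq_bigr => a _.
by rewrite scalerDr !scalerA mulrC.
Qed.

Lemma eq_linext f g : f =1 g -> linext f =1 linext g.
Proof. by move=> e x; apply: eq_bigr => a _; rewrite e. Qed.

End LinearExtension.

Lemma malg_ind_lin (K : fieldType) (X : choiceType)
    (P : {malg K[X]} -> Prop) :
  P 0 -> (forall c x y, P x -> P y -> P (c *: x + y)) ->
  (forall a, P << a >>) -> forall x, P x.
Proof.
move=> P0 PD PU x; rewrite (monalgE x).
elim: (X in \sum_(k <- X) _) => [|a s IH]; first by rewrite big_nil.
rewrite big_cons.
have -> : << x@_a *g a >> = x@_a *: (<< a >> : {malg K[X]}).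
  by apply/malgP => k; rewrite mcoeffZ !mcoeffU; case: eqP => _; rewrite ?mulr1 ?mulr0.
exact: PD.
Qed.

HB.mixin Record Lmodule_isLie (K : fieldType) g of GRing.Lmodule K g := {
  lie : g -> g -> g;
  lie_linearl : forall y, linear (lie^~ y);
  lie_linearr : forall x, linear (lie x);
  lie_alternating : forall x, lie x x = 0;
  lie_jacobi : forall x y z,
    lie x (lie y z) + lie y (lie z x) + lie z (lie x y) = 0
}.

#[short(type="lieAlgType")]
HB.structure Definition LieAlgebra (K : fieldType) :=
  { g of Lmodule_isLie K g & GRing.Lmodule K g }.

Record lieModule (K : fieldType) (g : lieAlgType K) := LieModule {
  carrier :> lmodType K;
  act : g -> carrier -> carrier;
  act_linearl : forall v, linear (act^~ v);
  act_linearr : forall x, linear (act x);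
  act_lie : forall x y v, act (lie x y) v = act x (act y v) - act y (act x v)
}.

Section LieModules.
Variables (K : fieldType) (g : lieAlgType K).

HB.instance Definition _ (M : lieModule g) (x : g) :=
  GRing.isLinear.Build K M M _ (@act K g M x) (@act_linearr K g M x).

Definition is_submodule (M : lieModule g) (S : M -> Prop) : Prop :=
  [/\ S 0,
      forall u v, S u -> S v -> S (u + v),
      forall (c : K) v, S v -> S (c *: v)
    & forall x v, S v -> S (act x v)].

Definition irreducible (M : lieModule g) : Prop :=
  (exists v : M, v <> 0) /\
  forall S : M -> Prop, is_submodule S ->
    (forall v, S v -> v = 0) \/ (forall v, S v).

Definition lie_iso (M N : lieModule g) : Prop :=
  exists phi : {linear M -> N},
    bijective phi /\ forall x v, phi (act x v) = act x (phi v).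

End LieModules.

Section TensorSpace.
Variables (K : fieldType) (V W : lmodType K).

Local Notation free := {malg K[(V * W)%type]}.

(* The subspace spanned by the bilinearity relations. *)
Inductive tensor_rel : free -> Prop :=
| TRel0 : tensor_rel 0
| TRelD c x y : tensor_rel x -> tensor_rel y -> tensor_rel (c *: x + y)
| TRelL c v1 v2 w : tensor_rel
    (<< (c *: v1 + v2, w) >> - c *: << (v1, w) >> - << (v2, w) >>)
| TRelR c v w1 w2 : tensor_rel
    (<< (v, c *: w1 + w2) >> - c *: << (v, w1) >> - << (v, w2) >>).

Definition tensor_relb : {pred free} := fun x => `[< tensor_rel x >].

Lemma tensor_rel_zmod_closed : zmod_closed tensor_relb.
Proof.
split=> [|x y /asboolP hx /asboolP hy]; apply/asboolP; first exact: TRel0.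
by rewrite addrC -scaleN1r; exact: TRelD.
Qed.

HB.instance Definition _ :=
  GRing.isZmodClosed.Build free tensor_relb tensor_rel_zmod_closed.

Definition tensor_space : Type := Quotient.quot (tensor_relb : zmodClosed free).

HB.instance Definition _ := GRing.Zmodule.on tensor_space.
HB.instance Definition _ := EqQuotient.on tensor_space.

Local Notation pi := (\pi_tensor_space : free -> tensor_space).

Lemma tpi_eq (x y : free) : (pi x = pi y) <-> tensor_rel (x - y).
Proof.
have E := Quotient.idealrBE (tensor_relb : zmodClosed free) x y.
split=> [e|h].
  by apply/asboolP; change (x - y \in (tensor_relb : zmodClosed free)); rewrite E e.
by apply/eqP; rewrite -[_ == _]E; exact/asboolP.
Qed.

Lemma tpiD (x y : free) : pi (x + y) = pi x + pi y.
Proof. exact: Quotient.pi_add. Qed.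

Fact tensor_scale_key : unit. Proof. by []. Qed.

Definition tensor_scale : K -> tensor_space -> tensor_space :=
  locked_with tensor_scale_key (fun c u => pi (c *: repr u)).

Lemma tensor_scale_pi c x : tensor_scale c (pi x) = pi (c *: x).
Proof.
rewrite [tensor_scale]unlock; apply/tpi_eq; rewrite -scalerBr -[_ *: _]addr0.
apply: TRelD; last exact: TRel0.
by apply/tpi_eq; exact: reprK.
Qed.

Lemma tensor_spaceP (u : tensor_space) : exists x, u = pi x.
Proof. by exists (repr u); rewrite reprK. Qed.

Lemma tensor_scaleA a b u :
  tensor_scale a (tensor_scale b u) = tensor_scale (a * b) u.
Proof.
case: (tensor_spaceP u) => x ->.
by rewrite (tensor_scale_pi b) !tensor_scale_pi scalerA.
Qed.

Lemma tensor_scale1 : left_id 1 tensor_scale.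
Proof.
by move=> u; case: (tensor_spaceP u) => x ->; rewrite tensor_scale_pi scale1r.
Qed.

Lemma tensor_scaleDr : right_distributive tensor_scale +%R.
Proof.
move=> a u v; case: (tensor_spaceP u) (tensor_spaceP v) => x -> [y ->].
by rewrite -tpiD !tensor_scale_pi -tpiD scalerDr.
Qed.

Lemma tensor_scaleDl u : {morph tensor_scale^~ u : a b / a + b}.
Proof.
move=> a b; case: (tensor_spaceP u) => x ->.
by rewrite !tensor_scale_pi -tpiD scalerDl.
Qed.

HB.instance Definition _ := GRing.Zmodule_isLmodule.Build K tensor_space
  tensor_scaleA tensor_scale1 tensor_scaleDr tensor_scaleDl.

Definition pure_tensor (v : V) (w : W) : tensor_space := pi << (v, w) >>.

Lemma tpi_is_linear : linear pi.
Proof. by move=> c x y; rewrite tpiD -tensor_scale_pi. Qed.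

Lemma pure_tensor_linearl w : linear (pure_tensor^~ w).
Proof.
move=> c v1 v2; rewrite /pure_tensor -tpi_is_linear; apply/tpi_eq.
by rewrite opprD addrA; exact: TRelL.
Qed.

Lemma pure_tensor_linearr v : linear (pure_tensor v).
Proof.
move=> c w1 w2; rewrite /pure_tensor -tpi_is_linear; apply/tpi_eq.
by rewrite opprD addrA; exact: TRelR.
Qed.

Lemma tensor_ind (P : tensor_space -> Prop) :
  P 0 -> (forall c x y, P x -> P y -> P (c *: x + y)) ->
  (forall v w, P (pure_tensor v w)) -> forall u, P u.
Proof.
move=> P0 PD PU u; case: (tensor_spaceP u) => x ->; elim/malg_ind_lin: x.
- have <- // : 0 = pi 0.
  by apply: (addrI (pi 0)); rewrite -tpiD !addr0.
- by move=> c x y hx hy; rewrite tpi_is_linear; exact: PD.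
by case.
Qed.

Definition tensor_lift (Z : lmodType K) (B : V -> W -> Z) (u : tensor_space) :=
  linext (fun p => B p.1 p.2) (repr u).

Section Lift.
Variables (Z : lmodType K) (B : V -> W -> Z).
Hypotheses (Bl : forall w, linear (B^~ w)) (Br : forall v, linear (B v)).

Lemma tensor_lift_pi x : tensor_lift B (pi x) = linext (fun p => B p.1 p.2) x.
Proof.
apply/eqP; rewrite -subr_eq0 -linearB /=; apply/eqP.
have : tensor_rel (repr (pi x) - x) by apply/tpi_eq; rewrite reprK.
elim=> [|c y z _ hy _ hz|c v1 v2 w|c v w1 w2].
- exact: linear0.
- by rewrite linearP /= hy hz scaler0 addr0.
- by rewrite !linearB linearZ /= !linextU /= Bl -addrA -opprD subrr.
by rewrite !linearB linearZ /= !linextU /= Br -addrA -opprD subrr.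
Qed.

Lemma tensor_lift_linear : linear (tensor_lift B).
Proof.
move=> c u v; case: (tensor_spaceP u) (tensor_spaceP v) => x -> [y ->].
rewrite -tpi_is_linear !tensor_lift_pi.
exact: linearP.
Qed.

Lemma tensor_liftE v w : tensor_lift B (pure_tensor v w) = B v w.
Proof. by rewrite tensor_lift_pi linextU. Qed.

End Lift.
End TensorSpace.

Section TensorModule.
Variables (K : fieldType) (g : lieAlgType K) (M N : lieModule g).

Local Notation "v ⊗ w" := (pure_tensor v w) (at level 40).

Definition tensor_act_pure (x : g) (v : M) (w : N) : tensor_space M N :=
  act x v ⊗ w + v ⊗ act x w.

Definition tensor_act (x : g) : tensor_space M N -> tensor_space M N :=
  tensor_lift (tensor_act_pure x).

Lemma tensor_act_purel x w : linear (tensor_act_pure x ^~ w).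
Proof.
move=> c u v; rewrite /tensor_act_pure linearP /= !pure_tensor_linearl.
by rewrite scalerDr addrACA.
Qed.

Lemma tensor_act_purer x v : linear (tensor_act_pure x v).
Proof.
move=> c u w; rewrite /tensor_act_pure linearP /= !pure_tensor_linearr.
by rewrite scalerDr addrACA.
Qed.

Lemma tensor_act_linearr x : linear (tensor_act x).
Proof.
by apply: tensor_lift_linear; [exact: tensor_act_purel | exact: tensor_act_purer].
Qed.

Lemma tensor_actE x v w :
  tensor_act x (v ⊗ w) = act x v ⊗ w + v ⊗ act x w.
Proof.
by apply: tensor_liftE; [exact: tensor_act_purel | exact: tensor_act_purer].
Qed.

HB.instance Definition _ x := GRing.isLinear.Build K
  (tensor_space M N) (tensor_space M N) _ (tensor_act x) (tensor_act_linearr x).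

Lemma tensor_act0 x : tensor_act x 0 = 0.
Proof. exact: linear0. Qed.

Lemma tensor_actB x u v : tensor_act x (u - v) = tensor_act x u - tensor_act x v.
Proof. exact: linearB. Qed.

Lemma tensor_actD x u v : tensor_act x (u + v) = tensor_act x u + tensor_act x v.
Proof. exact: linearD. Qed.

Lemma tensor_act_linearl u : linear (tensor_act^~ u).
Proof.
move=> c x y /=; elim/tensor_ind: u => [|b u v hu hv|v w].
- by rewrite !tensor_act0 scaler0 addr0.
- rewrite !(tensor_act_linearr _ b u v) hu hv !scalerDr !scalerA (mulrC b) -!addrA.
  by congr (_ + _); rewrite addrCA.
rewrite !tensor_actE !act_linearl pure_tensor_linearl pure_tensor_linearr.
by rewrite scalerDr addrACA.
Qed.

Lemma tensor_act_lie x y u :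
  tensor_act (lie x y) u =
  tensor_act x (tensor_act y u) - tensor_act y (tensor_act x u).
Proof.
elim/tensor_ind: u => [|b u v hu hv|v w].
- by rewrite !tensor_act0 subrr.
- rewrite !(tensor_act_linearr _ b u v) hu hv !tensor_act_linearr.
  rewrite scalerBr opprD -!addrA; congr (_ + _).
  by rewrite addrCA.
have Bl (v1 v2 : M) (w0 : N) : (v1 - v2) ⊗ w0 = v1 ⊗ w0 - v2 ⊗ w0.
  rewrite [v1 - v2]addrC -scaleN1r pure_tensor_linearl scaleN1r.
  by rewrite [RHS]addrC.
have Br (v0 : M) (w1 w2 : N) : v0 ⊗ (w1 - w2) = v0 ⊗ w1 - v0 ⊗ w2.
  rewrite [w1 - w2]addrC -scaleN1r pure_tensor_linearr scaleN1r.
  by rewrite [RHS]addrC.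
rewrite !tensor_actE !act_lie Bl Br.
rewrite !(tensor_actD _ (_ ⊗ _)) !tensor_actE.
set a := _ ⊗ w; set b := _ ⊗ w; set c := v ⊗ _; set d := v ⊗ _.
set p := _ ⊗ _; set q := _ ⊗ _.
rewrite (addrC q) (addrACA a p) (addrC p d) (addrACA b q) (addrC q p).
by rewrite (addrC (b + d)) addrKA opprD addrACA.
Qed.

Definition tensor_module : lieModule g :=
  @LieModule K g (tensor_space M N) tensor_act
    tensor_act_linearl tensor_act_linearr tensor_act_lie.

Lemma act_pure_tensor (x : g) (v : M) (w : N) :
  @act _ _ tensor_module x (v ⊗ w) = act x v ⊗ w + v ⊗ act x w.
Proof. exact: tensor_actE. Qed.

End TensorModule.

(* The right-nested tensor product M 0 ⊗ (M 1 ⊗ ( ... (M (m-1) ⊗ V))). *)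
Definition tensor_family (K : fieldType) (g : lieAlgType K) (m : nat)
    (M : 'I_m -> lieModule g) (V : lieModule g) : lieModule g :=
  \big[@tensor_module K g/V]_(i < m) M i.

Variant W22_basis := L_ of int | W_ of int | H_ of int.

Definition W22_encode (a : W22_basis) : int + int + int :=
  match a with L_ m => inl (inl m) | W_ m => inl (inr m) | H_ m => inr m end.

Definition W22_decode (u : int + int + int) : W22_basis :=
  match u with inl (inl m) => L_ m | inl (inr m) => W_ m | inr m => H_ m end.

Lemma W22_encodeK : cancel W22_encode W22_decode. Proof. by case. Qed.

HB.instance Definition _ := Countable.copy W22_basis (can_type W22_encodeK).

Section BilinearExtension.
Variables (K : fieldType) (X Y : choiceType) (Z : lmodType K).

Definition bilinext (B : X -> Y -> Z) (x : {malg K[X]}) (y : {malg K[Y]}) : Z :=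
  linext (fun a => linext (B a) y) x.

Lemma bilinext_linearl B y : linear (bilinext B ^~ y).
Proof. by move=> c u v; exact: linearP. Qed.

Lemma bilinext_linearr B x : linear (bilinext B x).
Proof.
move=> c u v; rewrite /bilinext -linext_funD; apply: eq_linext => a.
exact: linearP.
Qed.

Lemma bilinextU B a b : bilinext B << a >> << b >> = B a b.
Proof. by rewrite /bilinext !linextU. Qed.

End BilinearExtension.

Lemma sum3_scaleD (K : fieldType) (Z : lmodType K) (c : K) (a a' b b' d d' : Z) :
  c *: a + a' + (c *: b + b') + (c *: d + d')
  = c *: (a + b + d) + (a' + b' + d').
Proof.
rewrite !scalerDr (addrACA _ a'). by rewrite (addrACA _ (a' + b')).
Qed.

Lemma jacobi_basis (K : fieldType) (Z : lmodType K) (G : W22_basis -> Z)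
    (br : Z -> Z -> Z) :
  (forall x, br x 0 = 0) -> (forall c x y, br x (c *: y) = c *: br x y) ->
  (forall a b, br (G a) (G b) =
    match a, b with
    | L_ m, L_ n => (n - m)%:~R *: G (L_ (m + n))
    | L_ m, W_ n => (n - m)%:~R *: G (W_ (m + n))
    | W_ m, L_ n => (n - m)%:~R *: G (W_ (m + n))
    | L_ m, H_ n => n%:~R *: G (H_ (m + n))
    | H_ m, L_ n => (- m)%:~R *: G (H_ (m + n))
    | _, _ => 0
    end) ->
  forall a b d, br (G a) (br (G b) (G d)) + br (G b) (br (G d) (G a))
    + br (G d) (br (G a) (G b)) = 0.
Proof.
move=> br0 brZ brG a b d; rewrite !brG.
case: a b d => m [] n [] p; rewrite ?br0 ?brZ ?brG ?scaler0 ?addr0 //.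
all: rewrite !scalerA -!intrM (_ : n + (p + m) = m + (n + p)); last by ring.
all: rewrite (_ : p + (m + n) = m + (n + p)); last by ring.
all: rewrite -!scalerDl -!intrD.
all: rewrite [X in X%:~R](_ : _ = 0) ?scale0r //; ring.
Qed.

Section W22.
Variable K : numFieldType.

Definition W22 : Type := {malg K[W22_basis]}.

HB.instance Definition _ := GRing.Lmodule.on W22.

Definition W22_gen (a : W22_basis) : W22 := << a >>.
Definition W22_L (m : int) := W22_gen (L_ m).
Definition W22_W (m : int) := W22_gen (W_ m).
Definition W22_H (m : int) := W22_gen (H_ m).

Definition W22_bracket_gen (a b : W22_basis) : W22 :=
  match a, b with
  | L_ m, L_ n => (n - m)%:~R *: W22_L (m + n)
  | L_ m, W_ n => (n - m)%:~R *: W22_W (m + n)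
  | W_ m, L_ n => (n - m)%:~R *: W22_W (m + n)
  | L_ m, H_ n => n%:~R *: W22_H (m + n)
  | H_ m, L_ n => (- m)%:~R *: W22_H (m + n)
  | _, _ => 0
  end.

Fact W22_bracket_key : unit. Proof. by []. Qed.

Definition W22_bracket : W22 -> W22 -> W22 :=
  locked_with W22_bracket_key (bilinext W22_bracket_gen).

Lemma W22_bracketU a b :
  W22_bracket (W22_gen a) (W22_gen b) = W22_bracket_gen a b.
Proof. by rewrite [W22_bracket]unlock; exact: bilinextU. Qed.

Lemma W22_bracketl y : linear (W22_bracket^~ y).
Proof. by rewrite [W22_bracket]unlock; exact: bilinext_linearl. Qed.

Lemma W22_bracketr x : linear (W22_bracket x).
Proof. by rewrite [W22_bracket]unlock; exact: bilinext_linearr. Qed.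

Lemma W22_ind (P : W22 -> Prop) :
  P 0 -> (forall c x y, P x -> P y -> P (c *: x + y)) ->
  (forall a, P (W22_gen a)) -> forall x, P x.
Proof. exact: malg_ind_lin. Qed.

Lemma W22_bracket0l y : W22_bracket 0 y = 0.
Proof. by rewrite -[X in W22_bracket X](subrr 0) -scaleN1r addrC W22_bracketl scaleN1r addNr. Qed.

Lemma W22_bracket0r x : W22_bracket x 0 = 0.
Proof. by rewrite -[X in W22_bracket _ X](subrr 0) -scaleN1r addrC W22_bracketr scaleN1r addNr. Qed.

Lemma W22_bracketZr c x y : W22_bracket x (c *: y) = c *: W22_bracket x y.
Proof. by rewrite -[c *: y]addr0 W22_bracketr W22_bracket0r addr0. Qed.

Lemma W22_bracketZl c x y : W22_bracket (c *: x) y = c *: W22_bracket x y.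
Proof. by rewrite -[c *: x]addr0 W22_bracketl W22_bracket0l addr0. Qed.

Lemma W22_bracket_antisym x y : W22_bracket x y = - W22_bracket y x.
Proof.
elim/W22_ind: x => [|c x1 x2 h1 h2|a].
- by rewrite W22_bracket0l W22_bracket0r oppr0.
- by rewrite W22_bracketl W22_bracketr h1 h2 opprD scalerN.
elim/W22_ind: y => [|c x1 x2 h1 h2|b].
- by rewrite W22_bracket0l W22_bracket0r oppr0.
- by rewrite W22_bracketl W22_bracketr h1 h2 opprD scalerN.
rewrite !W22_bracketU; case: a b => m [] n /=; rewrite ?oppr0 //
  -scaleNr ?(addrC n m) -?mulrNz ?opprB ?opprK //.
Qed.

Lemma eq_opp0 (Z : lmodType K) (z : Z) : z = - z -> z = 0.
Proof.
move/eqP; rewrite -addr_eq0 -mulr2n -scaler_nat scaler_eq0.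
by rewrite Num.Theory.pnatr_eq0 => /eqP.
Qed.

Lemma W22_bracket_alt x : W22_bracket x x = 0.
Proof. exact/eq_opp0/W22_bracket_antisym. Qed.

Lemma W22_jacobi x y z :
  W22_bracket x (W22_bracket y z) + W22_bracket y (W22_bracket z x)
  + W22_bracket z (W22_bracket x y) = 0.
Proof.
pose E := (W22_bracketl, W22_bracketr, W22_bracket0l, W22_bracket0r).
elim/W22_ind: x => [|c x1 x2 h1 h2|a]; first by rewrite !E !addr0.
  by rewrite !E sum3_scaleD h1 h2 scaler0 addr0.
elim/W22_ind: y => [|c x1 x2 h1 h2|b]; first by rewrite !E !addr0.
  by rewrite !E sum3_scaleD h1 h2 scaler0 addr0.
elim/W22_ind: z => [|c x1 x2 h1 h2|d]; first by rewrite !E !addr0.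
  by rewrite !E sum3_scaleD h1 h2 scaler0 addr0.
apply: (jacobi_basis (G := W22_gen) W22_bracket0r W22_bracketZr).
by case=> p [] q; rewrite W22_bracketU.
Qed.

HB.instance Definition _ := Lmodule_isLie.Build K W22
  W22_bracketl W22_bracketr W22_bracket_alt W22_jacobi.

End W22.

Section W22Module.
Variables (K : numFieldType) (V : lmodType K) (rho : W22_basis -> V -> V).
Hypothesis rho_linear : forall a, linear (rho a).

Definition W22_act (x : W22 K) (v : V) : V := linext (rho^~ v) x.

Hypothesis rho_lie : forall a b v,
  W22_act (W22_bracket_gen K a b) v = rho a (rho b v) - rho b (rho a v).

Lemma W22_actU a v : W22_act (W22_gen K a) v = rho a v.
Proof. exact: linextU. Qed.

Lemma W22_act_linearl v : linear (W22_act^~ v).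
Proof. by move=> c x y; exact: linearP. Qed.

Lemma W22_act_linearr x : linear (W22_act x).
Proof.
move=> c u v; rewrite /W22_act -linext_funD; apply: eq_linext => a.
exact: rho_linear.
Qed.

Lemma W22_act_lie x y v :
  W22_act (lie x y) v = W22_act x (W22_act y v) - W22_act y (W22_act x v).
Proof.
have act0l u : W22_act 0 u = 0 by exact: linear0.
have act0r z : W22_act z 0 = 0.
  by have := W22_act_linearr z (-1) 0 0; rewrite scaler0 addr0 scaleN1r addNr.
change (lie x y) with (W22_bracket x y).
elim/W22_ind: x => [|c x1 x2 h1 h2|a].
- by rewrite W22_bracket0l !act0l act0r subrr.
- rewrite W22_bracketl !(W22_act_linearl _ c) h1 h2 W22_act_linearr.
  by rewrite scalerBr opprD addrACA.
elim/W22_ind: y => [|c x1 x2 h1 h2|b].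
- by rewrite W22_bracket0r !act0l act0r subrr.
- rewrite W22_bracketr !(W22_act_linearl _ c) h1 h2 W22_act_linearr.
  by rewrite scalerBr opprD addrACA.
by rewrite W22_bracketU !W22_actU.
Qed.

Definition W22_module : lieModule (W22 K) :=
  @LieModule K (W22 K) V W22_act W22_act_linearl W22_act_linearr W22_act_lie.

End W22Module.

Definition restricted (K : numFieldType) (V : lieModule (W22 K)) : Prop :=
  forall v : V, exists n : nat, forall m : int, n%:Z < m ->
    [/\ act (W22_L K m) v = 0, act (W22_W K m) v = 0 & act (W22_H K m) v = 0].

Section Families.
Variable K : numFieldType.

Definition hpoly (alpha : K) (n : int) (k : nat) : {poly K} :=
  n%:~R *: 'X^k
  - ((n * (n - 1))%:~R * alpha) *:
      (('X^k - (alpha ^+ k)%:P) %/ ('X - alpha%:P)).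

(* The finite sequence [xi] stands for a finitely supported family. *)
Definition in_Talpha (alpha : K) (h : int -> {poly K}) : Prop :=
  exists xi : seq K, forall m : int,
    h m = \sum_(i < size xi) xi`_i *: hpoly alpha m i.

Record Talpha (alpha : K) := MkTalpha {
  family :> int -> {poly K};
  familyP : in_Talpha alpha family
}.

Lemma hpoly_quot (alpha : K) (h : Talpha alpha) :
  exists P Q : {poly K}, P^`() = Q + ('X - alpha%:P) * Q^`() /\
    forall m : int, h m = m%:~R *: P - ((m * (m - 1))%:~R * alpha) *: Q.
Proof.
case: h => h [xi hE] /=.
pose q k : {poly K} := ('X^k - (alpha ^+ k)%:P) %/ ('X - alpha%:P).
have qE k : ('X - alpha%:P) * q k = 'X^k - (alpha ^+ k)%:P.
  rewrite mulrC divpK // dvdp_XsubCl rootE !hornerE ?hornerXn subrr //.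
exists (\sum_(i < size xi) xi`_i *: 'X^i), (\sum_(i < size xi) xi`_i *: q i).
split=> [|m].
  rewrite !raddf_sum /= mulr_sumr -big_split /=; apply: eq_bigr => i _.
  rewrite !derivZ -scalerAr -scalerDr; congr (_ *: _).
  have := congr1 (@deriv K) (qE i).
  by rewrite derivM !derivE !subr0 mul1r => ->.
rewrite hE !scaler_sumr -sumrB; apply: eq_bigr => i _.
by rewrite /hpoly scalerBr !scalerA ![xi`_i * _]mulrC.
Qed.

End Families.

(* C[t, s] is C[t][s]: the outer variable is s and the inner one is t. *)
Definition polyts (K : fieldType) : Type := {poly {poly K}}.

HB.instance Definition _ (K : fieldType) := GRing.Zmodule.on (polyts K).

Section PolytsModule.
Variable K : fieldType.

Definition polyts_scale (c : K) (f : polyts K) : polyts K :=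
  c%:P *: (f : {poly {poly K}}).

Lemma polyts_scaleA a b f :
  polyts_scale a (polyts_scale b f) = polyts_scale (a * b) f.
Proof. by rewrite /polyts_scale scalerA polyCM. Qed.

Lemma polyts_scale1 : left_id 1 polyts_scale.
Proof. by move=> f; rewrite /polyts_scale polyC1 scale1r. Qed.

Lemma polyts_scaleDr : right_distributive polyts_scale +%R.
Proof. by move=> a f g; rewrite /polyts_scale; exact: scalerDr. Qed.

Lemma polyts_scaleDl f : {morph polyts_scale^~ f : a b / a + b}.
Proof. by move=> a b; rewrite /polyts_scale polyCD; exact: scalerDl. Qed.

HB.instance Definition _ := GRing.Zmodule_isLmodule.Build K (polyts K)
  polyts_scaleA polyts_scale1 polyts_scaleDr polyts_scaleDl.

End PolytsModule.

Section Psi.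
Variable K : numFieldType.
Local Notation Kts := {poly {poly K}}.

(* f(t, s) |-> f(t, s + m) *)
Definition shift_s (m : int) (f : Kts) : Kts := f \Po ('X + m%:~R%:P).

Definition deriv_t (f : Kts) : Kts := map_poly (@deriv K) f.

Lemma deriv_tE f i : (deriv_t f)`_i = (f`_i)^`().
Proof. by rewrite coef_map_id0 // deriv0. Qed.

Lemma deriv_tD f g : deriv_t (f + g) = deriv_t f + deriv_t g.
Proof. by apply/polyP => i; rewrite !(coefD, deriv_tE) derivD. Qed.

Lemma deriv_tM f g : deriv_t (f * g) = deriv_t f * g + f * deriv_t g.
Proof.
apply/polyP => i; rewrite coefD deriv_tE !coefM raddf_sum -big_split /=.
by apply: eq_bigr => j _; rewrite !deriv_tE derivM.
Qed.

Lemma deriv_tC (p : {poly K}) : deriv_t p%:P = (p^`())%:P.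
Proof.
apply/polyP => i; rewrite deriv_tE !coefC.
by case: eqP => // _; rewrite deriv0.
Qed.

Lemma deriv_tX : deriv_t 'X = 0.
Proof.
apply/polyP => i; rewrite deriv_tE coefX coef0.
by case: eqP => _; rewrite ?derivC // deriv0.
Qed.

Lemma shift_sD m f g : shift_s m (f + g) = shift_s m f + shift_s m g.
Proof. exact: comp_polyD. Qed.

Lemma shift_sM m f g : shift_s m (f * g) = shift_s m f * shift_s m g.
Proof. exact: comp_polyM. Qed.

Lemma shift_sC m (p : {poly K}) : shift_s m p%:P = p%:P.
Proof. exact: comp_polyC. Qed.

Lemma shift_sX m : shift_s m 'X = 'X + m%:~R%:P.
Proof. exact: comp_polyX. Qed.

Lemma shift_s_shift_s m n f : shift_s m (shift_s n f) = shift_s (m + n) f.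
Proof.
rewrite /shift_s -comp_polyA comp_polyD comp_polyX comp_polyC -addrA.
by rewrite -polyCD -intrD.
Qed.

Lemma deriv_t_shift_s m f : deriv_t (shift_s m f) = shift_s m (deriv_t f).
Proof.
elim/poly_ind: f => [|f c IH].
  by rewrite /shift_s /deriv_t comp_poly0 map_poly0 comp_poly0.
rewrite !(shift_sD, shift_sM, deriv_tD, deriv_tM, shift_sC, deriv_tC, shift_sX).
have -> : (m%:~R : {poly K})^`() = 0 by rewrite -(rmorph_int (@polyC K)) derivC.
by rewrite IH deriv_tX polyC0 addr0 [shift_s m 0]comp_poly0.
Qed.

Local Notation cst c := (c%:P%:P : Kts).
Local Notation t := (('X : {poly K})%:P : Kts).
Local Notation s := ('X : Kts).

Variables (lam alpha beta : K) (h : Talpha alpha).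

(* [(h m \Po - 'X)%:P] is h_m(-t). *)
Definition Psi_act_gen (a : W22_basis) (f : polyts K) : polyts K :=
  match a with
  | L_ m =>
      - (cst (lam ^ m) * (s - (h m \Po - 'X)%:P) * shift_s m f)
      - cst (m%:~R * lam ^ m) * (t + cst (m%:~R * alpha))
        * deriv_t (shift_s m f)
  | W_ m => cst (lam ^ m) * (t + cst (m%:~R * alpha)) * shift_s m f
  | H_ m => cst (lam ^ m * beta) * shift_s m f
  end.

Lemma Psi_act_gen_linear a : linear (Psi_act_gen a).
Proof.
move=> c f g; rewrite /GRing.scale /= /polyts_scale -!mul_polyC.
have SD m : shift_s m (c%:P%:P * f + g) = c%:P%:P * shift_s m f + shift_s m g.
  by rewrite shift_sD shift_sM shift_sC.
have DD (u v : Kts) : deriv_t (c%:P%:P * u + v) = c%:P%:P * deriv_t u + deriv_t v.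
  by rewrite deriv_tD deriv_tM deriv_tC derivC polyC0 mul0r add0r.
by case: a => m /=; rewrite SD ?DD; ring.
Qed.

Hypothesis lam_neq0 : lam != 0.

Lemma Psi_act_gen_lie a b f :
  W22_act Psi_act_gen (W22_bracket_gen K a b) f =
  Psi_act_gen a (Psi_act_gen b f) - Psi_act_gen b (Psi_act_gen a f).
Proof.
have act0 : W22_act Psi_act_gen 0 f = 0 by exact: linear0.
have actZ c d : W22_act Psi_act_gen (c *: W22_gen K d) f =
    cst c * Psi_act_gen d f.
  rewrite /W22_act linearZ /= linextU /GRing.scale /= /polyts_scale.
  by rewrite mul_polyC.
have cE : (forall x y : K, cst (x + y) = cst x + cst y) *
    (forall x y : K, cst (x * y) = cst x * cst y) *
    (forall x : K, cst (- x) = - cst x).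
  by do !split=> *; rewrite ?(polyCD, polyCM, polyCN).
have dcst c : deriv_t (cst c) = 0 by rewrite deriv_tC derivC.
have dt1 : deriv_t t = 1 by rewrite deriv_tC derivX.
have dN (u : Kts) : deriv_t (- u) = - deriv_t u.
  by apply/polyP => i; rewrite !(coefN, deriv_tE) derivN.
have sN m (u : Kts) : shift_s m (- u) = - shift_s m u by exact: raddfN.
have mE (m : int) : (m%:~R%:P : Kts) = cst (m%:~R).
  by rewrite -(rmorph_int (@polyC K)).
have [P [Q [PQ hE]]] := hpoly_quot h.
pose p0 : Kts := (P \Po - 'X)%:P; pose q0 : Kts := (Q \Po - 'X)%:P.
pose q1 : Kts := (Q^`() \Po - 'X)%:P.
have HE m : (h m \Po - 'X)%:P =
    cst m%:~R * p0 - cst (m%:~R * (m%:~R - 1) * alpha) * q0.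
  rewrite hE comp_polyB !comp_polyZ -!mul_polyC polyCB !polyCM.
  by rewrite !intrM !intrD /= !polyCM.
have dp0 : deriv_t p0 = - (q0 - (t + cst alpha) * q1).
  rewrite deriv_tC deriv_comp PQ comp_polyD comp_polyM comp_polyB comp_polyX.
  rewrite comp_polyC derivN derivX !(polyCM, polyCD, polyCN) /q0 /q1.
  by ring.
have dq0 : deriv_t q0 = - q1.
  by rewrite deriv_tC deriv_comp derivN derivX polyCM polyCN mulrN1.
have sp0 m : shift_s m p0 = p0 by exact: shift_sC.
have sq0 m : shift_s m q0 = q0 by exact: shift_sC.
have lamD m n : lam ^ (m + n) = lam ^ m * lam ^ n by exact: expfzDr.
have E := (shift_sM, shift_sD, sN, shift_sC, shift_sX, sp0, sq0,
  deriv_tM, deriv_tD, dN, deriv_tX, dcst, dt1, dp0, dq0, mE).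
case: a b => m [] n; rewrite /W22_bracket_gen ?act0 ?actZ /Psi_act_gen ?HE.
all: rewrite !E.
all: rewrite -?deriv_t_shift_s ?shift_s_shift_s ?(addrC n m).
all: rewrite ?lamD ?intrD ?mulrNz !cE.
all: set F := shift_s (m + n) f; set F1 := deriv_t F; try set F2 := deriv_t F1.
all: ring.
Qed.

Definition Psi : lieModule (W22 K) :=
  @W22_module K (polyts K) Psi_act_gen Psi_act_gen_linear Psi_act_gen_lie.

Lemma Psi_actE (a : W22_basis) (f : Psi) :
  act (W22_gen K a) f = Psi_act_gen a f.
Proof. exact: W22_actU. Qed.

End Psi.

Arguments Psi {K} lam alpha beta h lam_neq0.

(* Main.v *)
(** A subspace of Psi ⊗ N stable under Psi-action on the first factor is stable
    under t, s, the shifts of s and both partial derivatives: L_0 and W_0 are -s and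
    t, and W_a W_b - W_0 W_(a+b) is a b alpha^2 lambda^(a+b) times the shift by
    a + b, which is where alpha <> 0 enters.  Lowering degrees, such a nonzero
    subspace contains Psi ⊗ n for some n <> 0.

    On a tensor product, the part of k |-> X_k u coming from the factor with parameter
    lambda_i is lambda_i^k times a polynomial in k, and the part coming from the
    restricted module vanishes for large k.  For distinct lambda_i these parts can
    be separated by recurrence operators, so a submodule is stable under each
    tensor factor separately, and one inducts on the number of factors.

    Conversely, contraction with linear forms turns submodules of N into submodules
    of M ⊗ N; if alpha = 0, the multiples of t form a submodule; and if
    lambda_i = lambda_j, so do the vectors on which the shifts of s_i and s_j agree,
    to which s_i does not belong. *)
From HB Require Import structures.
Require Import Defs.
From mathcomp Require Import all_boot all_order all_algebra.
From mathcomp Require Import reals complex.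
From mathcomp Require Import boolp ring zify.

Set Implicit Arguments.
Unset Strict Implicit.
Unset Printing Implicit Defensive.

Import GRing.Theory Num.Theory Order.TTheory.
Local Open Scope ring_scope.

(** * Linear maps on tensor products *)

Definition mklinear (K : fieldType) (V W : lmodType K) (D : V -> W)
    (DP : linear D) : {linear V -> W} :=
  HB.pack D (GRing.isLinear.Build K V W _ D DP).

Section TensorMaps.
Variable K : fieldType.
Implicit Types V W : lmodType K.

Lemma pure_tensor0l V W (w : W) : pure_tensor (0 : V) w = 0.
Proof.
by have := pure_tensor_linearl w (-1) (0 : V) 0; rewrite scaler0 addr0 scaleN1r addNr.
Qed.

Lemma pure_tensor0r V W (v : V) : pure_tensor v (0 : W) = 0.
Proof.
by have := pure_tensor_linearr v (-1) (0 : W) 0; rewrite scaler0 addr0 scaleN1r addNr.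
Qed.

Lemma pure_tensorDl V W (v1 v2 : V) (w : W) :
  pure_tensor (v1 + v2) w = pure_tensor v1 w + pure_tensor v2 w.
Proof. by have := pure_tensor_linearl w 1 v1 v2; rewrite !scale1r. Qed.

Lemma pure_tensorDr V W (v : V) (w1 w2 : W) :
  pure_tensor v (w1 + w2) = pure_tensor v w1 + pure_tensor v w2.
Proof. by have := pure_tensor_linearr v 1 w1 w2; rewrite !scale1r. Qed.

Lemma pure_tensorZl V W c (v : V) (w : W) :
  pure_tensor (c *: v) w = c *: pure_tensor v w.
Proof.
by have := pure_tensor_linearl w c v 0; rewrite !addr0 pure_tensor0l addr0.
Qed.

Lemma pure_tensorZr V W c (v : V) (w : W) :
  pure_tensor v (c *: w) = c *: pure_tensor v w.
Proof.
by have := pure_tensor_linearr v c w 0; rewrite !addr0 pure_tensor0r addr0.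
Qed.

Lemma pure_tensorBl V W (v1 v2 : V) (w : W) :
  pure_tensor (v1 - v2) w = pure_tensor v1 w - pure_tensor v2 w.
Proof. by rewrite -scaleN1r pure_tensorDl pure_tensorZl scaleN1r. Qed.

Lemma pure_tensorBr V W (v : V) (w1 w2 : W) :
  pure_tensor v (w1 - w2) = pure_tensor v w1 - pure_tensor v w2.
Proof. by rewrite -scaleN1r pure_tensorDr pure_tensorZr scaleN1r. Qed.

Lemma tensor_ext V W (Z : lmodType K) (f g : tensor_space V W -> Z) :
  (forall c (u v : tensor_space V W), f (c *: u + v) = c *: f u + f v) ->
  (forall c (u v : tensor_space V W), g (c *: u + v) = c *: g u + g v) ->
  (forall v w, f (pure_tensor v w) = g (pure_tensor v w)) -> f =1 g.
Proof.
move=> fl gl e.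
have z (h : tensor_space V W -> Z) :
    (forall c (u v : tensor_space V W), h (c *: u + v) = c *: h u + h v) -> h 0 = 0.
  by move=> hl; have := hl (-1) 0 0; rewrite scaler0 addr0 scaleN1r addNr.
elim/tensor_ind=> [|c x y hx hy|v w]; [by rewrite !z | by rewrite fl gl hx hy |].
exact: e.
Qed.

Definition tmap V V' W W' (D : V -> V') (B : W -> W')
    (u : tensor_space V W) : tensor_space V' W' :=
  tensor_lift (fun v w => pure_tensor (D v) (B w)) u.

Section Tmap.
Variables (V V' W W' : lmodType K).
Variables (D : {linear V -> V'}) (B : {linear W -> W'}).

Let Bl w : linear (fun v => pure_tensor (D v) (B w)).
Proof. by move=> c v1 v2; rewrite linearP pure_tensor_linearl. Qed.

Let Br v : linear (fun w => pure_tensor (D v) (B w)).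
Proof. by move=> c v1 v2; rewrite linearP pure_tensor_linearr. Qed.

Lemma tmap_is_linear : linear (tmap D B).
Proof. exact: (tensor_lift_linear Bl Br). Qed.

HB.instance Definition _ := GRing.isLinear.Build K
  (tensor_space V W) (tensor_space V' W') _ (tmap D B) tmap_is_linear.

Lemma tmapP c u v : tmap D B (c *: u + v) = c *: tmap D B u + tmap D B v.
Proof. exact: tmap_is_linear. Qed.

Lemma tmap0 : tmap D B 0 = 0.
Proof. exact: linear0. Qed.

Lemma tmapE v w : tmap D B (pure_tensor v w) = pure_tensor (D v) (B w).
Proof. exact: (tensor_liftE Bl Br). Qed.

End Tmap.

Lemma tmapDr V V' W W' (D : {linear V -> V'}) (B : {linear W -> W'})
    (u v : tensor_space V W) : tmap D B (u + v) = tmap D B u + tmap D B v.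
Proof. by have := tmapP D B 1 u v; rewrite !scale1r. Qed.

Lemma tmaplE V V' W (D : {linear V -> V'}) (v : V) (w : W) :
  tmap D idfun (pure_tensor v w) = pure_tensor (D v) w.
Proof. exact: (tmapE D idfun). Qed.

Lemma tmaprE V W W' (B : {linear W -> W'}) (v : V) (w : W) :
  tmap idfun B (pure_tensor v w) = pure_tensor v (B w).
Proof. exact: (tmapE idfun B). Qed.

Definition contract V W (phi : V -> K) (u : tensor_space V W) : W :=
  tensor_lift (fun v w => phi v *: w) u.

Section Contract.
Variables (V W : lmodType K) (phi : {linear V -> K^o}).

Let Bl (w : W) : linear (fun v => phi v *: w).
Proof. by move=> c v1 v2; rewrite linearP scalerDl scalerA. Qed.

Let Br v : linear (fun w : W => phi v *: w).
Proof. by move=> c v1 v2; rewrite scalerDr !scalerA mulrC. Qed.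

Lemma contract_is_linear : linear (@contract V W phi).
Proof. exact: (tensor_lift_linear Bl Br). Qed.

HB.instance Definition _ := GRing.isLinear.Build K
  (tensor_space V W) W _ (@contract V W phi) contract_is_linear.

Lemma contractP c u v :
  @contract V W phi (c *: u + v) = c *: contract phi u + contract phi v.
Proof. exact: contract_is_linear. Qed.

Lemma contractE v w : @contract V W phi (pure_tensor v w) = phi v *: w.
Proof. exact: (tensor_liftE Bl Br). Qed.

Lemma pure_tensor_neq0 v (w : W) : phi v = 1 -> w <> 0 -> pure_tensor v w <> 0.
Proof.
move=> phi1 w0 e; apply: w0.
by rewrite -[w]scale1r -phi1 -contractE e linear0.
Qed.

End Contract.

Lemma tmap_comp V V' V'' W W' W'' (D : {linear V -> V'}) (D' : {linear V' -> V''})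
    (B : {linear W -> W'}) (B' : {linear W' -> W''}) u :
  tmap D' B' (tmap D B u) = tmap (D' \o D) (B' \o B) u.
Proof.
move: u; apply: tensor_ext => [c x y||v w].
- by rewrite !tmapP.
- exact: tmap_is_linear.
by rewrite !tmapE.
Qed.

Lemma eq_tmap V V' W W' (D D' : {linear V -> V'}) (B B' : {linear W -> W'}) :
  D =1 D' -> B =1 B' -> tmap D B =1 tmap D' B'.
Proof.
move=> eD eB; apply: tensor_ext => [||v w]; [exact: tmap_is_linear..|].
by rewrite !tmapE eD eB.
Qed.

Lemma tmap_id V W (u : tensor_space V W) : tmap idfun idfun u = u.
Proof. move: u; apply: tensor_ext => [||v w] //; [exact: tmap_is_linear | exact: tmapE]. Qed.

Lemma tmapl_comp V V' V'' W (D : {linear V -> V'}) (D' : {linear V' -> V''})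
    (u : tensor_space V W) :
  tmap D' idfun (tmap D idfun u) = tmap (D' \o D) idfun u.
Proof. by rewrite tmap_comp; exact: eq_tmap. Qed.

Lemma tmaprl_comm V V' W W' (D : {linear V -> V'}) (B : {linear W -> W'})
    (u : tensor_space V W) :
  tmap idfun B (tmap D idfun u) = tmap D idfun (tmap idfun B u).
Proof. by rewrite !tmap_comp; exact: eq_tmap. Qed.

Lemma tmap_combl V V' W W' c (D1 D2 : {linear V -> V'}) (B : {linear W -> W'}) u :
  tmap (c \*: D1 \+ D2) B u = c *: tmap D1 B u + tmap D2 B u.
Proof.
move: u; apply: tensor_ext => [|a u v|v w]; first exact: tmap_is_linear.
  rewrite !tmapP !scalerDr addrACA !scalerA [a * c]mulrC //.
by rewrite !tmapE pure_tensorDl pure_tensorZl.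
Qed.

Lemma tmap_commute0 V W (D E : {linear V -> V}) : D \o E =1 E \o D ->
  forall u : tensor_space V W, tmap D idfun u = 0 ->
  tmap D idfun (tmap E idfun u) = 0.
Proof.
move=> DE u Du.
by rewrite tmapl_comp (eq_tmap (D' := E \o D) DE (fun=> erefl)) -tmapl_comp Du tmap0.
Qed.

Lemma tmap_kernel V W (D J C : {linear V -> V}) (u : tensor_space V W) :
  (forall f, J (D f) = f - C f) -> tmap D idfun u = 0 -> u = tmap C idfun u.
Proof.
move=> JD Du; rewrite -[LHS]tmap_id.
have -> : tmap idfun idfun u = tmap (1 \*: C \+ (J \o D)) idfun u.
  by apply: eq_tmap => // f /=; rewrite scale1r JD addrC subrK.
by rewrite tmap_combl scale1r -tmapl_comp Du tmap0 addr0.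
Qed.

Lemma tmap_rank1 V W (C : {linear V -> V}) (phi : {linear V -> K^o}) (e : V)
    (u : tensor_space V W) :
  (forall v, C v = phi v *: e) -> tmap C idfun u = pure_tensor e (contract phi u).
Proof.
move=> CE; move: u; apply: tensor_ext => [|c x y|v w]; first exact: tmap_is_linear.
  by rewrite contractP pure_tensor_linearr.
by rewrite tmaplE contractE pure_tensorZr -pure_tensorZl CE.
Qed.

End TensorMaps.

Lemma act_tensor (K : fieldType) (g : lieAlgType K) (M N : lieModule g) x
    (u : tensor_module M N) :
  act x u = tmap (act x) idfun u + tmap idfun (act x) u.
Proof.
pose G (u : tensor_space M N) : tensor_space M N :=
  tmap (act x) idfun u + tmap idfun (act x) u.
apply: (tensor_ext (f := tensor_act x) (g := G)) => [||v w].
- exact: tensor_act_linearr.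
- by move=> c y z; rewrite /G !tmapP scalerDr addrACA.
by rewrite /G tensor_actE tmaplE tmaprE.
Qed.

(** * Operators on C[t, s] *)

Definition polyts1 (K : fieldType) : polyts K := (1 : {poly {poly K}}).

Section PolytsOperators.
Variable K : numFieldType.
Local Notation Kts := {poly {poly K}}.
Local Notation cst c := (c%:P%:P : Kts).
Local Notation t := (('X : {poly K})%:P : Kts).
Implicit Types f : polyts K.

Lemma polyts_scaleE (c : K) f : c *: f = cst c * (f : Kts) :> Kts.
Proof. by rewrite mul_polyC. Qed.

Lemma coef_polyts_scale (c : K) f i : ((c *: f : polyts K) : Kts)`_i = c *: (f : Kts)`_i.
Proof. by rewrite polyts_scaleE coefCM mul_polyC. Qed.

Lemma polyts_linear_comm (D : Kts -> Kts) :
  (forall p q, D (p + q) = D p + D q) ->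
  (forall (c : K) p, D (cst c * p) = cst c * D p) ->
  linear (D : polyts K -> polyts K).
Proof. by move=> DD DZ c f g; rewrite !polyts_scaleE DD DZ. Qed.

Lemma shift_s_linear m : linear (@shift_s K m : polyts K -> polyts K).
Proof.
apply: polyts_linear_comm => [p q|c p]; first exact: shift_sD.
by rewrite shift_sM shift_sC.
Qed.

Lemma deriv_t_linear : linear (@deriv_t K : polyts K -> polyts K).
Proof.
apply: polyts_linear_comm => [p q|c p]; first exact: deriv_tD.
by rewrite deriv_tM deriv_tC derivC mul0r add0r.
Qed.

Lemma deriv_s_linear : linear (@deriv {poly K} : polyts K -> polyts K).
Proof.
apply: polyts_linear_comm => [p q|c p]; first exact: derivD.
by rewrite derivM derivC mul0r add0r.
Qed.

Lemma mul_linear (p : Kts) : linear ( *%R p : polyts K -> polyts K).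
Proof. by apply: polyts_linear_comm => [q r|c q]; ring. Qed.

Lemma shift_s0 (f : Kts) : shift_s 0 f = f.
Proof. by rewrite /shift_s addr0 comp_polyXr. Qed.

Lemma shift_s_taylor (m : int) (f : Kts) d : (size f <= d)%N ->
  shift_s m f = \sum_(j < d) cst (m%:~R ^+ j) * f^`N(j).
Proof.
move=> sf; rewrite /shift_s /comp_poly nderiv_taylor; last exact: mulrC.
rewrite size_map_polyC (big_ord_widen d
  (fun j => (map_poly polyC f)^`N(j).['X] * m%:~R%:P ^+ j) sf) //.
rewrite big_mkcond /=.
apply: eq_bigr => j _; rewrite nderivn_map mulrC.
rewrite -/(comp_poly 'X _) comp_polyXr.
have -> : (m%:~R%:P ^+ j : Kts) = cst (m%:~R ^+ j).
  by rewrite !rmorphXn /= !rmorph_int.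
case: ltnP => // le; rewrite nderivn_poly0 ?mulr0 //.
Qed.

(* Inverting the Vandermonde matrix of 0, 1, ..., d.+1 expresses the derivative
   at s, read off from the Taylor expansions of the shifts, through the shifts. *)
Lemma deriv_s_shifts d : exists c : 'I_d.+2 -> K, forall f : polyts K,
  (size (f : Kts) <= d.+2)%N ->
  (f : Kts)^`() = \sum_(k < d.+2) cst (c k) * shift_s (k : nat) f.
Proof.
pose a : 'rV[K]_d.+2 := \row_k (k : nat)%:R.
pose V := Vandermonde d.+2 a.
have Vu : V \in unitmx.
  rewrite unitmxE det_Vandermonde unitfE; apply/prodf_neq0 => i _.
  apply/prodf_neq0 => j ij; rewrite !mxE subr_eq0 eqr_nat.
  by rewrite gtn_eqF.
pose c := invmx V *m (delta_mx 1 0 : 'cV_d.+2).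
exists (fun k => c k 0) => f sf.
have cE (j : 'I_d.+2) : \sum_(k < d.+2) (k : nat)%:R ^+ j * c k 0 = (j == 1)%:R.
  have := congr1 (fun M : 'cV_d.+2 => M j 0) (mulKVmx Vu (delta_mx 1 0)).
  rewrite [RHS]mxE andbT => <-; rewrite [RHS]mxE; apply: eq_bigr => k _.
  by rewrite !mxE.
under eq_bigr => k _ do rewrite (shift_s_taylor _ sf) mulr_sumr.
have -> : (f : Kts)^`() = \sum_(j < d.+2) cst ((j == 1)%:R) * (f : Kts)^`N(j).
  rewrite (bigD1 1) //= big1 ?addr0 => [|j /negbTE ->]; last by rewrite mul0r.
  by rewrite ?eqxx !polyC1 mul1r; symmetry; exact: nderivn1.
rewrite exchange_big; apply: eq_bigr => j _ /=.
rewrite -cE !rmorph_sum /= mulr_suml; apply: eq_bigr => k _.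
by rewrite mulrA -!polyCM [c k 0 * _]mulrC.
Qed.

Lemma coef0_linear : linear (fun f : polyts K => ((f : Kts)`_0)%:P : polyts K).
Proof.
apply: polyts_linear_comm => [p q|c p]; first by rewrite coefD polyCD.
by rewrite coefCM polyCM.
Qed.

Definition antideriv_s (f : Kts) : Kts :=
  \poly_(i < (size f).+1) ((i%:R^-1)%:P * f`_i.-1).

(* The coefficient 0 comes out right because 0^-1 = 0. *)
Lemma antideriv_sE f i : (antideriv_s f)`_i = (i%:R^-1)%:P * (f : Kts)`_i.-1.
Proof.
rewrite coef_poly; case: ltnP => //; case: i => // i; rewrite ltnS => le.
by rewrite nth_default ?mulr0.
Qed.

Lemma antideriv_s_linear : linear (antideriv_s : polyts K -> polyts K).
Proof.
apply: polyts_linear_comm => [p q|c p]; apply/polyP => i.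
  by rewrite coefD !antideriv_sE coefD mulrDr.
by rewrite coefCM !antideriv_sE coefCM mulrCA.
Qed.

Lemma deriv_sK f : antideriv_s (f : Kts)^`() = (f : Kts) - ((f : Kts)`_0)%:P.
Proof.
apply/polyP => -[|i]; rewrite antideriv_sE coefB coefC /= ?subrr.
  by rewrite invr0 mul0r.
rewrite coef_deriv subr0 -[X in _ * X]mulr_natl mulrA -polyC_natr -polyCM mulVf ?mul1r //.
by rewrite pnatr_eq0.
Qed.

Definition antideriv_t (f : Kts) : Kts :=
  map_poly (fun p : {poly K} => \poly_(i < (size p).+1) (i%:R^-1 * p`_i.-1)) f.

Lemma antideriv_tE f i j :
  (antideriv_t f)`_i`_j = j%:R^-1 * (f : Kts)`_i`_j.-1.
Proof.
rewrite coef_map_id0; last first.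
  by apply/polyP => k; rewrite coef_poly !coef0 mulr0 if_same.
rewrite coef_poly; case: ltnP => //; case: j => // j; rewrite ltnS => le.
by rewrite nth_default ?mulr0.
Qed.

Lemma antideriv_t_linear : linear (antideriv_t : polyts K -> polyts K).
Proof.
apply: polyts_linear_comm => [p q|c p]; apply/polyP => i; apply/polyP => j.
  by rewrite !coefD !antideriv_tE !coefD mulrDr.
by rewrite !coefCM !antideriv_tE !coefCM mulrCA.
Qed.

Definition eval_t0 (f : Kts) : Kts := map_poly (fun p : {poly K} => (p`_0)%:P) f.

Lemma eval_t0E f i : (eval_t0 f)`_i = ((f : Kts)`_i`_0)%:P.
Proof. by rewrite coef_map_id0 // coef0. Qed.

Lemma eval_t0D f g : eval_t0 ((f : Kts) + g) = eval_t0 f + eval_t0 g.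
Proof. by apply/polyP => i; rewrite !(coefD, eval_t0E) polyCD. Qed.

Lemma eval_t0_linear : linear (eval_t0 : polyts K -> polyts K).
Proof.
apply: polyts_linear_comm => [p q|c p]; first exact: eval_t0D.
by apply/polyP => i; rewrite !(coefCM, eval_t0E) polyCM.
Qed.

Lemma deriv_tK f : antideriv_t (deriv_t f) = (f : Kts) - eval_t0 f.
Proof.
apply/polyP => i; apply/polyP => -[|j].
  by rewrite antideriv_tE !coefB eval_t0E coefC invr0 mul0r subrr.
rewrite antideriv_tE !coefB eval_t0E coefC subr0 deriv_tE coef_deriv -[X in _ * X]mulr_natl.
by rewrite mulrA mulVf ?mul1r // pnatr_eq0.
Qed.

Lemma coef00_linear :
  linear (fun f : polyts K => (f : Kts)`_0`_0 : K^o).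
Proof. by move=> c f g; rewrite !coefD coef_polyts_scale coefZ. Qed.

Lemma coef00_1 : (polyts1 K : Kts)`_0`_0 = 1 :> K.
Proof. by rewrite /polyts1 !coef1. Qed.

Lemma deriv_s_nilp f : exists d, iter d (@deriv {poly K}) f = 0.
Proof. by exists (size (f : Kts)); rewrite -/(derivn _ _) derivn_poly0. Qed.

Lemma deriv_t_nilp f : exists d, iter d (@deriv_t K) f = 0.
Proof.
exists (\max_(i < size (f : Kts)) size ((f : Kts)`_i)%R).
have it d i : (iter d (@deriv_t K) f)`_i = iter d (@deriv K) ((f : Kts)`_i).
  by elim: d => //= d IH; rewrite deriv_tE IH.
apply/polyP => i; rewrite it coef0 -/(derivn _ _) derivn_poly0 //.
case: (ltnP i (size (f : Kts))) => [lt|le]; first exact: (leq_bigmax (Ordinal lt)).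
by rewrite nth_default // size_poly0.
Qed.

Lemma Psi_act_W0 lam alpha beta (k : Talpha alpha) (f : polyts K) :
  Psi_act_gen lam beta k (W_ 0) f = t * (f : Kts).
Proof. by rewrite /= expr0z mul0r polyC0 addr0 shift_s0 !polyC1 mul1r. Qed.

Lemma Psi_act_L0 lam alpha beta (k : Talpha alpha) (f : polyts K) :
  Psi_act_gen lam beta k (L_ 0) f = - ('X * (f : Kts)).
Proof.
have [P [Q [_ hE]]] := hpoly_quot k.
rewrite /= expr0z hE mul0r mulr0z !mul0r !scale0r subrr comp_poly0 !polyC0.
by rewrite !subr0 shift_s0 !polyC1 mul1r.
Qed.

End PolytsOperators.

Section Stabilizers.
Variables (K : fieldType) (U N : lmodType K) (S : tensor_space U N -> Prop).
Hypothesis SP : forall c u v, S u -> S v -> S (c *: u + v).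

Definition stabilizes (D : U -> U) : Prop :=
  exists D' : {linear U -> U},
    D' =1 D /\ forall u, S u -> S (tmap D' idfun u).

Lemma eq_stabilizes D1 D2 : D1 =1 D2 -> stabilizes D1 -> stabilizes D2.
Proof. by move=> e [D [eD sD]]; exists D; split=> // f; rewrite eD. Qed.

Lemma stabilizes_comp D1 D2 :
  stabilizes D1 -> stabilizes D2 -> stabilizes (fun f => D1 (D2 f)).
Proof.
move=> [D1' [e1 s1]] [D2' [e2 s2]]; exists (D1' \o D2'); split=> [f|u Su].
  by rewrite /= e1 e2.
by have := s1 _ (s2 _ Su); rewrite tmapl_comp.
Qed.

Lemma stabilizesP c D1 D2 :
  stabilizes D1 -> stabilizes D2 -> stabilizes (fun f => c *: D1 f + D2 f).
Proof.
move=> [D1' [e1 s1]] [D2' [e2 s2]].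
exists ((c \*: D1') \+ D2'); split=> [f|u Su]; first by rewrite /= e1 e2.
rewrite tmap_combl.
by apply: SP; [exact: s1 | exact: s2].
Qed.

Lemma stabilizes_id : stabilizes id.
Proof. by exists idfun; split=> // u; rewrite tmap_id. Qed.

Lemma stabilizes0 : stabilizes (fun=> 0).
Proof.
apply: eq_stabilizes (stabilizesP (-1) stabilizes_id stabilizes_id) => f.
by rewrite scaleN1r addNr.
Qed.

Lemma stabilizesZ c D : stabilizes D -> stabilizes (fun f => c *: D f).
Proof.
move=> sD; apply: eq_stabilizes (stabilizesP c sD stabilizes0) => f.
by rewrite addr0.
Qed.

Lemma stabilizesD D1 D2 :
  stabilizes D1 -> stabilizes D2 -> stabilizes (fun f => D1 f + D2 f).
Proof.
move=> s1 s2; apply: eq_stabilizes (stabilizesP 1 s1 s2) => f.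
by rewrite scale1r.
Qed.

Lemma stabilizesB D1 D2 :
  stabilizes D1 -> stabilizes D2 -> stabilizes (fun f => D1 f - D2 f).
Proof.
move=> s1 s2; apply: eq_stabilizes (stabilizesP (-1) s2 s1) => f.
by rewrite scaleN1r addrC.
Qed.


Lemma nilpotent_kernel (D : {linear U -> U}) :
  (forall f, exists d, iter d D f = 0) -> stabilizes D ->
  forall (Q : tensor_space (U) N -> Prop) u, S u -> u <> 0 -> Q u ->
  (forall v, Q v -> Q (tmap D idfun v)) ->
  exists v, [/\ S v, v <> 0, Q v & tmap D idfun v = 0].
Proof.
move=> Dnil [D' [eD sD]] Q u Su u0 Qu QD.
have sD1 v : S v -> S (tmap D idfun v).
  by move=> Sv; rewrite -(eq_tmap eD (fun=> erefl)); exact: sD.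
pose F v : tensor_space (U) N := tmap D idfun v.
have F0 d : iter d F 0 = 0 by elim: d => //= d ->; exact: tmap0.
have Fadd d e v : iter d F v = 0 -> iter (e + d) F v = 0.
  by rewrite iterD => ->.
have FP d c v w : iter d F (c *: v + w) = c *: iter d F v + iter d F w.
  by elim: d => //= d ->; rewrite /F tmapP.
have [d hd] : exists d, iter d F u = 0.
  elim/tensor_ind: {Su u0 Qu} u => [|c v w [d hd] [e he]|f n]; first by exists 0.
    by exists (d + e)%N; rewrite FP (Fadd _ _ _ he) addnC (Fadd _ _ _ hd) scaler0 addr0.
  have [d hd] := Dnil f; exists d.
  suff -> : iter d F (pure_tensor f n) = pure_tensor (iter d D f) n.
    by rewrite hd pure_tensor0l.
  elim: {hd} d => [|d IH]; first by [].
  by rewrite !iterS IH /F tmaplE.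
elim: d u Su u0 Qu hd => [|d IH] u Su u0 Qu; first by move=> /u0.
rewrite iterSr => hd; have [Fu0|/eqP Fu0] := eqVneq (F u) 0; first by exists u.
exact: IH (sD1 _ Su) Fu0 (QD _ Qu) hd.
Qed.

Lemma stabilizes_local (P : nat -> U -> Prop) (D : U -> U) :
  (exists D' : {linear U -> U}, D' =1 D) ->
  (forall d e f, (d <= e)%N -> P d f -> P e f) -> (forall f, exists d, P d f) ->
  (forall d, exists D', stabilizes D' /\ forall f, P d f -> D f = D' f) ->
  stabilizes D.
Proof.
move=> [D1 D1E] Pmono Pex Ploc; exists D1; split=> // u Su.
have [d ud] : exists d, forall e, (d <= e)%N -> forall D' : {linear U -> U},
    (forall f, P e f -> D1 f = D' f) -> tmap D1 idfun u = tmap D' idfun u.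
  elim/tensor_ind: {Su} u => [|c u v [d hd] [e he]|f n].
  - by exists 0%N => e _ D' _; rewrite !tmap0.
  - exists (maxn d e) => k; rewrite geq_max => /andP[dk ek] D' hD'.
    by rewrite !tmapP (hd _ dk _ hD') (he _ ek _ hD').
  have [d Pd] := Pex f; exists d => e de D' hD'.
  by rewrite !tmaplE hD' //; exact: Pmono Pd.
have [D' [[D2 [D2E sD2]] hD']] := Ploc d.
by rewrite (ud d (leqnn d) D2) => [|f Pf]; [exact: sD2 | rewrite D1E D2E hD'].
Qed.

End Stabilizers.

Section PsiTensorCore.
Variables (K : numFieldType) (lam alpha beta : K) (h : Talpha alpha).
Hypotheses (lam_neq0 : lam != 0) (alpha_neq0 : alpha != 0).
Variables (N : lmodType K) (S : tensor_space (polyts K) N -> Prop).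
Hypothesis SP : forall c u v, S u -> S v -> S (c *: u + v).

Local Notation Kts := {poly {poly K}}.
Local Notation cst c := (c%:P%:P : Kts).
Local Notation t := (('X : {poly K})%:P : Kts).
Local Notation X := (Psi_act_gen lam beta h).

Local Notation stabilizes := (stabilizes S).
Hypothesis SX : forall a, stabilizes (X a).
Let stabilizes_id := stabilizes_id S.
Let stabilizesP := stabilizesP SP.
Let stabilizes0 := stabilizes0 SP.
Let stabilizesZ := stabilizesZ SP.
Let stabilizesD := stabilizesD SP.
Let stabilizesB := stabilizesB SP.


Let cstM (x y : K) : cst (x * y) = cst x * cst y. Proof. by rewrite !polyCM. Qed.
Let cstD (x y : K) : cst (x + y) = cst x + cst y. Proof. by rewrite !polyCD. Qed.
Let cstN (x : K) : cst (- x) = - cst x. Proof. by rewrite !polyCN. Qed.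
Let cstV (x : K) (f : Kts) : x != 0 -> cst x^-1 * (cst x * f) = f.
Proof. by move=> x0; rewrite mulrA -cstM mulVf // !polyC1 mul1r. Qed.

Lemma stabilizes_t : stabilizes ( *%R t).
Proof. by apply: eq_stabilizes (SX (W_ 0)) => f; exact: Psi_act_W0. Qed.

Lemma stabilizes_s : stabilizes ( *%R 'X).
Proof.
apply: eq_stabilizes (stabilizesZ (-1) (SX (L_ 0))) => f.
by rewrite Psi_act_L0 scaleN1r; exact: opprK.
Qed.

(* W_a W_b - W_0 W_m with a + b = m is a b alpha^2 lambda^m times the shift. *)
Lemma stabilizes_shift m : stabilizes (shift_s m).
Proof.
have [a [b [ab a0 b0]]] : exists a b : int, [/\ a + b = m, a != 0 & b != 0].
  case: (m =P 1) => [->|/eqP m1]; first by exists 2, (-1).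
  by exists 1, (m - 1); split=> //; rewrite ?subr_eq0 // addrC subrK.
pose c := lam ^ m * (a%:~R * b%:~R * alpha ^+ 2).
have c0 : c != 0 by rewrite !mulf_neq0 ?expf_neq0 ?expfz_neq0 ?intr_eq0.
have := stabilizesZ c^-1 (stabilizesB
  (stabilizes_comp (SX (W_ a)) (SX (W_ b))) (stabilizes_comp (SX (W_ 0)) (SX (W_ m)))).
apply: eq_stabilizes => f; rewrite polyts_scaleE -[RHS](cstV _ c0); congr (_ * _).
rewrite /= !(shift_sM, shift_sD, shift_sC) !shift_s_shift_s ab add0r expr0z.
rewrite /c -ab expfzDr // mulr0z intrD expr2 !(cstM, cstD).
set F := shift_s _ _; rewrite !polyC0 !polyC1; ring.
Qed.

Lemma stabilizes_mult (p : {poly K}) : stabilizes ( *%R (p%:P : Kts)).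
Proof.
elim/poly_ind: p => [|p c IH].
  by apply: eq_stabilizes stabilizes0 => f; rewrite polyC0 mul0r.
have := stabilizesD (stabilizes_comp stabilizes_t IH) (stabilizesZ c stabilizes_id).
apply: eq_stabilizes => f; rewrite polyts_scaleE polyCD polyCM.
by rewrite mulrDl [_ * t]mulrC mulrA.
Qed.

Lemma stabilizes_mul (p : Kts) : stabilizes ( *%R p).
Proof.
elim/poly_ind: p => [|p c IH].
  by apply: eq_stabilizes stabilizes0 => f; rewrite mul0r.
have := stabilizesD (stabilizes_comp stabilizes_s IH) (stabilizes_mult c).
by apply: eq_stabilizes => f; rewrite mulrDl [_ * 'X]mulrC mulrA.
Qed.

Lemma stabilizes_deriv_t : stabilizes (@deriv_t K).
Proof.
have key m : m != 0 -> stabilizes (fun f : polyts K => (t + cst (m%:~R * alpha)) * deriv_t f).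
  move=> m0; pose c := - (m%:~R * lam ^ m : K).
  have c0 : c != 0 by rewrite oppr_eq0 mulf_neq0 ?intr_eq0 ?expfz_neq0.
  have sL := stabilizes_comp (SX (L_ m)) (stabilizes_shift (- m)).
  have sM := stabilizes_mult ((lam ^ m)%:P * (h m \Po - 'X)).
  have sS := stabilizesZ (lam ^ m) stabilizes_s.
  apply: eq_stabilizes (stabilizesZ c^-1 (stabilizesB (stabilizesD sL sS) sM)) => f.
  rewrite !polyts_scaleE -[RHS](cstV _ c0); congr (_ * _).
  rewrite /= shift_s_shift_s addrN shift_s0 /c cstN cstM !polyCM.
  set p := _ \Po _; ring.
have := stabilizesZ alpha^-1 (stabilizesB (key 2 isT) (key 1 isT)).
apply: eq_stabilizes => f; rewrite polyts_scaleE -[RHS](cstV _ alpha_neq0).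
congr (_ * _); rewrite /= -mulrBl; congr (_ * _).
by rewrite opprD addrACA subrr add0r -!polyCB -mulrBl -intrB mul1r.
Qed.

Lemma stabilizes_deriv_s : stabilizes (@deriv {poly K}).
Proof.
apply: (@stabilizes_local K (polyts K) N S (fun d f => (size (f : Kts) <= d.+2)%N)).
- by exists (mklinear (@deriv_s_linear K)).
- by move=> d e f de /leq_trans; apply; rewrite !ltnS.
- by move=> f; exists (size (f : Kts)); rewrite -addn2 leq_addr.
move=> d; have [c cP] := deriv_s_shifts K d.
exists (fun f => \sum_(k < d.+2) c k *: (shift_s (k : nat) f : polyts K)); split.
  elim: (index_enum _) => [|k r IH].
    by apply: eq_stabilizes stabilizes0 => f; rewrite big_nil.
  apply: eq_stabilizes (stabilizesP (c k) (stabilizes_shift (k : nat)) IH) => f.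
  by rewrite big_cons.
by move=> f sf; rewrite cP //; apply: eq_bigr => k _; rewrite polyts_scaleE.
Qed.

Lemma psi_tensor_line : (exists2 u, S u & u <> 0) ->
  exists2 n : N, n <> 0 & forall f : polyts K, S (pure_tensor f n).
Proof.
move=> [u Su u0].
pose Ds := mklinear (@deriv_s_linear K).
pose Dt := mklinear (@deriv_t_linear K).
have dst : Ds \o Dt =1 Dt \o Ds.
  move=> f /=; apply/polyP => i.
  by rewrite coef_deriv !deriv_tE coef_deriv derivMn.
have [v [Sv v0 _ dsv]] := @nilpotent_kernel _ _ _ _ Ds (@deriv_s_nilp K)
  stabilizes_deriv_s (fun=> True) u Su u0 I (fun _ _ => I).
have [w [Sw w0 dsw dtw]] := @nilpotent_kernel _ _ _ _ Dt (@deriv_t_nilp K)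
  stabilizes_deriv_t (fun w => tmap Ds idfun w = 0) v Sv v0 dsv (tmap_commute0 dst).
have w1 := tmap_kernel (D := Ds) (J := mklinear (@antideriv_s_linear K))
  (C := mklinear (@coef0_linear K)) (@deriv_sK K) dsw.
have w2 := tmap_kernel (D := Dt) (J := mklinear (@antideriv_t_linear K))
  (C := mklinear (@eval_t0_linear K)) (@deriv_tK K) dtw.
have wE : w = pure_tensor (polyts1 K) (contract (mklinear (@coef00_linear K)) w).
  rewrite [LHS]w1 {1}w2 tmapl_comp; apply: tmap_rank1 => f /=.
  by rewrite eval_t0E polyts_scaleE mulr1.
exists (contract (mklinear (@coef00_linear K)) w) => [e|f].
  by apply: w0; rewrite wE e pure_tensor0r.
have [D [eD sD]] := stabilizes_mul f.
by have := sD _ Sw; rewrite {1}wE tmaplE eD mulr1.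
Qed.

End PsiTensorCore.

(** * Sequences annihilated by recurrence operators *)

Section Recurrences.
Variables (K : fieldType) (Z : lmodType K).
Implicit Types (a b : int -> Z) (p q : {poly K}).

(* [recur q a] is q(E) a, where E is the shift operator on sequences. *)
Definition recur q a (k : int) : Z := \sum_(j < size q) q`_j *: a (k + j%:Z).

Lemma recur_widen q a k d : (size q <= d)%N ->
  recur q a k = \sum_(j < d) q`_j *: a (k + j%:Z).
Proof.
move=> le; rewrite /recur (big_ord_widen d (fun j => q`_j *: a (k + j%:Z)) le).
rewrite big_mkcond /=; apply: eq_bigr => j _; case: ltnP => // ge.
by rewrite nth_default ?scale0r.
Qed.

Lemma recurDl p q a k : recur (p + q) a k = recur p a k + recur q a k.
Proof.
pose d := maxn (size p) (size q).
rewrite (recur_widen _ _ (size_polyD p q)) (recur_widen _ _ (leq_maxl _ _ : (size p <= d)%N)).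
rewrite (recur_widen _ _ (leq_maxr _ _ : (size q <= d)%N)) -big_split /=.
by apply: eq_bigr => j _; rewrite coefD scalerDl.
Qed.

Lemma recurC c a k : recur c%:P a k = c *: a k.
Proof.
by rewrite (recur_widen _ _ (size_polyC_leq1 c)) big_ord1 coefC addr0.
Qed.

Lemma recurMX q a k : recur (q * 'X) a k = recur q a (k + 1).
Proof.
have le : (size (q * 'X)%R <= (size q).+1)%N.
  by rewrite (leq_trans (size_polyMleq _ _)) // size_polyX addn2.
rewrite (recur_widen _ _ le) big_ord_recl coefMX eqxx scale0r add0r.
apply: eq_bigr => j _; rewrite coefMX /= add0n; congr (_ *: a _).
by rewrite -addrA.
Qed.

Lemma recurDr q a b k :
  recur q (fun i => a i + b i) k = recur q a k + recur q b k.
Proof. by rewrite -big_split; apply: eq_bigr => j _; rewrite scalerDr. Qed.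

Lemma recurZr q c a k : recur q (fun i => c *: a i) k = c *: recur q a k.
Proof. by rewrite scaler_sumr; apply: eq_bigr => j _; rewrite !scalerA mulrC. Qed.

Lemma recur_shift q a k m : recur q (fun i => a (i + m)) k = recur q a (k + m).
Proof. by apply: eq_bigr => j _; rewrite addrAC. Qed.

Lemma eq_recur q a b k : (forall i, k <= i -> a i = b i) -> recur q a k = recur q b k.
Proof. by move=> e; apply: eq_bigr => j _; rewrite e // lerDl. Qed.

Lemma recur_eq0 q a k : (forall i, k <= i -> a i = 0) -> recur q a k = 0.
Proof. by move=> e; apply: big1 => j _; rewrite e ?scaler0 // lerDl. Qed.

Lemma recurM p q a k : recur (p * q) a k = recur p (recur q a) k.
Proof.
elim/poly_ind: p k => [|p c IH] k.
  by rewrite mul0r -polyC0 !recurC !scale0r.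
rewrite mulrDl !recurDl recurC recurMX -IH; congr (_ + _).
  by rewrite mulrAC recurMX.
elim/poly_ind: q {IH} k => [|q d IH] k.
  by rewrite mulr0 -polyC0 !recurC !scale0r scaler0.
rewrite mulrDr !recurDl scalerDr -polyCM !recurC scalerA mulrA recurMX IH.
by rewrite recurMX.
Qed.

Lemma recurMXn q a k n : recur (q * 'X^n) a k = recur q a (k + n%:Z).
Proof.
elim: n k => [|n IH] k; first by rewrite mulr1 addr0.
by rewrite exprSr mulrA recurMX IH -addrA.
Qed.

Definition ev_recur q a : Prop := exists n : int, forall k, n <= k -> recur q a k = 0.

Lemma ev_recurMl p q a : ev_recur q a -> ev_recur (p * q) a.
Proof.
move=> [n h]; exists n => k nk; rewrite recurM recur_eq0 // => i ki.
exact/h/(le_trans nk).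
Qed.

Lemma ev_recurMr p q a : ev_recur p a -> ev_recur (p * q) a.
Proof. by rewrite mulrC; exact: ev_recurMl. Qed.

Lemma ev_recurD q a b : ev_recur q a -> ev_recur q b ->
  ev_recur q (fun k => a k + b k).
Proof.
move=> [m hm] [n hn]; exists (Order.max m n) => k; rewrite ge_max => /andP[mk nk].
by rewrite recurDr hm ?hn ?addr0.
Qed.

Lemma ev_recurZ q c a : ev_recur q a -> ev_recur q (fun k => c *: a k).
Proof. by move=> [n h]; exists n => k nk; rewrite recurZr h ?scaler0. Qed.

Lemma ev_recur_ext q a b : a =1 b -> ev_recur q a -> ev_recur q b.
Proof.
move=> e [n h]; exists n => k nk; rewrite -(h k nk).
by apply: eq_recur => i _.
Qed.

Lemma recur_closed (S : Z -> Prop) q a k : S 0 ->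
  (forall c u v, S u -> S v -> S (c *: u + v)) ->
  (forall i, S (a i)) -> S (recur q a k).
Proof.
move=> S0 SP Sa; rewrite /recur; elim: (index_enum _) => [|j r IH].
  by rewrite big_nil.
by rewrite big_cons; exact: SP.
Qed.

(* If q(lam) <> 0, a Bezout relation u q X^n + v (X - lam)^d = 1 writes each term
   of a as a combination of terms of a + c lying in the range where q(E) c = 0. *)
Lemma recur_split (S : Z -> Prop) lam d q a c : S 0 ->
  (forall e u v, S u -> S v -> S (e *: u + v)) ->
  (forall k, S (a k + c k)) -> lam != 0 -> ~~ root q lam ->
  (forall k, recur (('X - lam%:P) ^+ d) a k = 0) -> ev_recur q c ->
  forall k, S (a k).
Proof.
move=> S0 SP Sac lam0 qlam ha [n hc] k.
pose M := `|n - k|%N.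
have : coprimep (q * 'X^M) (('X - lam%:P) ^+ d).
  apply: coprimep_expr; rewrite coprimep_XsubC rootM negb_or qlam.
  by rewrite /root hornerXn expf_neq0.
move/Bezout_eq1_coprimepP => [[u v] /= uv].
have -> : a k = recur (u * q) (fun i => a i + c i) (k + M%:Z).
  rewrite recurDr [X in _ + X]recurM [X in _ + X]recur_eq0; last first.
    by move=> i ki; apply: hc; rewrite /M in ki; lia.
  rewrite addr0 -recurMXn -mulrA -[a k]scale1r -recurC polyC1 -uv recurDl.
  by rewrite [X in _ + X]recurM [X in _ + X]recur_eq0 ?addr0.
exact: recur_closed.
Qed.

Definition exp_poly lam a : Prop :=
  exists d, forall k, recur (('X - lam%:P) ^+ d) a k = 0.

Lemma exp_poly_ext lam a b : a =1 b -> exp_poly lam a -> exp_poly lam b.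
Proof.
by move=> e [d h]; exists d => k; rewrite -(h k); apply: eq_recur => i _.
Qed.

Lemma exp_polyP lam c a b : exp_poly lam a -> exp_poly lam b ->
  exp_poly lam (fun k => c *: a k + b k).
Proof.
move=> [d hd] [e he]; exists (d + e)%N => k.
rewrite recurDr recurZr exprD [X in _ + X]recurM [X in _ + X]recur_eq0 //.
by rewrite mulrC recurM recur_eq0 ?scaler0 ?addr0.
Qed.

Lemma exp_poly0 lam : exp_poly lam (fun=> 0).
Proof. by exists 0%N => k; rewrite recur_eq0. Qed.

Lemma exp_polyZ lam c a : exp_poly lam a -> exp_poly lam (fun k => c *: a k).
Proof.
move=> ha; apply: exp_poly_ext (exp_polyP c ha (exp_poly0 lam)) => k.
by rewrite addr0.
Qed.

Lemma exp_polyD lam a b : exp_poly lam a -> exp_poly lam b ->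
  exp_poly lam (fun k => a k + b k).
Proof.
move=> ha hb; apply: exp_poly_ext (exp_polyP 1 ha hb) => k.
by rewrite scale1r.
Qed.

Lemma recur_XsubC lam a k : recur ('X - lam%:P) a k = a (k + 1) - lam *: a k.
Proof. by rewrite -polyCN recurDl -['X]mul1r recurMX -polyC1 !recurC scale1r scaleNr. Qed.

Lemma exp_poly_exp lam z : lam != 0 -> exp_poly lam (fun k => lam ^ k *: z).
Proof.
move=> lam0; exists 1%N => k; rewrite recur_XsubC scalerA.
by rewrite expfzDr // expr1z mulrC subrr.
Qed.

Lemma exp_poly_mulk lam a : exp_poly lam a -> exp_poly lam (fun k => k%:~R *: a k).
Proof.
move=> [d]; elim: d a => [|d IH] a ha.
  apply: exp_poly_ext (exp_poly0 lam) => k.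
  by have := ha k; rewrite expr0 -polyC1 recurC scale1r => ->; rewrite scaler0.
have [e he] : exp_poly lam (recur ('X - lam%:P) (fun k => k%:~R *: a k)).
  have : exp_poly lam (fun k => k%:~R *: recur ('X - lam%:P) a k + a (k + 1)).
    apply: exp_polyD.
      by apply: IH => k; rewrite -recurM -exprSr.
    by exists d.+1 => k; rewrite recur_shift.
  apply: exp_poly_ext => k; rewrite !recur_XsubC intrD scalerDl scale1r.
  by rewrite scalerBr !scalerA [lam * _]mulrC addrAC.
by exists e.+1 => k; rewrite exprSr recurM.
Qed.

End Recurrences.

Lemma recur_linear (K : fieldType) (Y Z : lmodType K) (F : {linear Y -> Z}) q a k :
  recur q (fun i => F (a i)) k = F (recur q a k).
Proof. by rewrite linear_sum; apply: eq_bigr => j _; rewrite linearZ. Qed.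

Lemma exp_poly_linear (K : fieldType) (Y Z : lmodType K) (F : {linear Y -> Z}) lam a :
  exp_poly lam a -> exp_poly lam (fun k => F (a k)).
Proof. by move=> [d h]; exists d => k; rewrite recur_linear h linear0. Qed.

Lemma ev_recur_linear (K : fieldType) (Y Z : lmodType K) (F : {linear Y -> Z}) q a :
  ev_recur q a -> ev_recur q (fun k => F (a k)).
Proof. by move=> [n h]; exists n => k nk; rewrite recur_linear h ?linear0. Qed.

Variant W22_kind : (int -> W22_basis) -> Prop :=
| KindL : W22_kind L_
| KindW : W22_kind W_
| KindH : W22_kind H_.

Lemma W22_kindP a : exists2 G, W22_kind G & exists k, a = G k.
Proof. by case: a => k; [exists L_|exists W_|exists H_]; first [constructor | exists k]. Qed.

Lemma act0v (K : fieldType) (g : lieAlgType K) (M : lieModule g) (v : M) : act 0 v = 0.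
Proof. by have := act_linearl v (-1) 0 0; rewrite scaler0 addr0 scaleN1r addNr. Qed.

Section PsiSequences.
Variables (K : numFieldType) (lam alpha beta : K) (h : Talpha alpha).
Hypothesis lam_neq0 : lam != 0.

Local Notation Kts := {poly {poly K}}.
Local Notation cst c := (c%:P%:P : Kts).
Local Notation t := (('X : {poly K})%:P : Kts).

Lemma exp_poly_shift (f : polyts K) :
  exp_poly lam (fun k => lam ^ k *: (shift_s k f : polyts K)).
Proof.
have hj j (g : polyts K) : exp_poly lam (fun k => (k%:~R ^+ j * lam ^ k) *: g).
  elim: j => [|j IH].
    by apply: exp_poly_ext (exp_poly_exp g lam_neq0) => k; rewrite mul1r.
  apply: exp_poly_ext (exp_poly_mulk IH) => k.
  by rewrite scalerA mulrA exprS.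
suff : exp_poly lam (fun k => \sum_(j < size (f : Kts))
    (k%:~R ^+ j * lam ^ k) *: ((f : Kts)^`N(j) : polyts K)).
  apply: exp_poly_ext => k; rewrite (shift_s_taylor _ (leqnn (size (f : Kts)))).
  rewrite polyts_scaleE mulr_sumr; apply: eq_bigr => j _.
  by rewrite polyts_scaleE mulrA -!polyCM [lam ^ k * _]mulrC.
elim: (index_enum _) => [|j r IH].
  by apply: exp_poly_ext (exp_poly0 _ lam) => k; rewrite big_nil.
apply: exp_poly_ext (exp_polyD (hj j _) IH) => k.
by rewrite big_cons.
Qed.

Lemma exp_poly_mul (p : Kts) (a : int -> polyts K) :
  exp_poly lam a -> exp_poly lam (fun k => p * (a k : Kts) : polyts K).
Proof. exact: (exp_poly_linear (mklinear (mul_linear p))). Qed.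

Lemma exp_poly_Psi G (f : polyts K) : W22_kind G ->
  exp_poly lam (fun k => Psi_act_gen lam beta h (G k) f).
Proof.
have sh := exp_poly_shift f; case.
- have [P [Q [_ hE]]] := hpoly_quot h.
  pose A1 := exp_poly_mul ((P \Po - 'X)%:P + (alpha *: (Q \Po - 'X))%:P) (exp_poly_mulk sh).
  pose A2 := exp_poly_mul ((- alpha) *: (Q \Po - 'X))%:P (exp_poly_mulk (exp_poly_mulk sh)).
  have sd := exp_poly_shift (deriv_t f : polyts K).
  pose B1 := exp_poly_mul (- t) (exp_poly_mulk sd).
  pose B2 := exp_polyZ (- alpha) (exp_poly_mulk (exp_poly_mulk sd)).
  have := exp_polyD (exp_polyD (exp_poly_mul (- 'X) sh) (exp_polyD A1 A2)) (exp_polyD B1 B2).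
  apply: exp_poly_ext => k; rewrite !polyts_scaleE /= deriv_t_shift_s hE.
  rewrite comp_polyB !comp_polyZ -!mul_polyC.
  rewrite intrM intrB !(polyCM, polyCN, polyCD).
  set F := shift_s k f; set F1 := shift_s k _.
  ring.
- have := exp_polyD (exp_poly_mul t sh) (exp_polyZ alpha (exp_poly_mulk sh)).
  apply: exp_poly_ext => k; rewrite !polyts_scaleE /= !polyCM.
  ring.
apply: exp_poly_ext (exp_polyZ beta sh) => k.
by rewrite !polyts_scaleE /= !polyCM mulrA [cst beta * _]mulrC.
Qed.

End PsiSequences.

(* The annihilator may depend on the vector; [Lam] controls its roots only. *)
Definition tame (K : numFieldType) (Lam : K -> Prop) (N : lieModule (W22 K)) : Prop :=
  forall G (u : N), W22_kind G -> exists q, (forall z, root q z -> Lam z) /\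
    ev_recur q (fun k => act (W22_gen K (G k)) u).

Lemma restricted_tame (K : numFieldType) (Lam : K -> Prop) (V : lieModule (W22 K)) :
  restricted V -> tame Lam V.
Proof.
move=> rV G u kG; exists 1; split=> [z|]; first by rewrite (negbTE (root1 _)).
have [n hn] := rV u; exists (n%:Z + 1) => k nk; rewrite -polyC1 recurC.
have /hn[] : n%:Z < k by lia.
by case: kG => hL hW hH; rewrite (hL, hW, hH) scaler0.
Qed.

Lemma sub_tame (K : numFieldType) (Lam Lam' : K -> Prop) (N : lieModule (W22 K)) :
  (forall z, Lam z -> Lam' z) -> tame Lam N -> tame Lam' N.
Proof.
move=> sub tN G u kG; have [q [rq hq]] := tN G u kG.
by exists q; split=> // z /rq /sub.
Qed.

Section PsiTensor.
Variables (K : numFieldType) (lam alpha beta : K) (h : Talpha alpha).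
Hypothesis lam_neq0 : lam != 0.
Variables (Lam : K -> Prop) (N : lieModule (W22 K)).
Hypothesis tN : tame Lam N.

Local Notation M := (Psi lam alpha beta h lam_neq0).
Local Notation MN := (tensor_module M N).

Lemma tame_right G (u : MN) : W22_kind G ->
  exists q, (forall z, root q z -> Lam z) /\
    ev_recur q (fun k => tmap (idfun : M -> M) (act (W22_gen K (G k)) : N -> N) u).
Proof.
move=> kG; elim/tensor_ind: u => [|c u v [q [rq hq]] [p [rp hp]]|f n].
- exists 1; split=> [z|]; first by rewrite (negbTE (root1 _)).
  by exists 0 => k _; rewrite recur_eq0 // => i _; rewrite tmap0.
- exists (q * p); split=> [z|].
    by rewrite rootM => /orP[/rq | /rp].
  apply: ev_recur_ext (ev_recurD (ev_recurMr p (ev_recurZ c hq)) (ev_recurMl q hp)) => k.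
  by rewrite tmapP.
have [q [rq hq]] := tN n kG; exists q; split=> //.
pose F := mklinear (pure_tensor_linearr (f : M) : linear (pure_tensor f : N -> _)).
apply: ev_recur_ext (ev_recur_linear F hq) => k.
by rewrite tmaprE.
Qed.

Lemma tame_left G (u : MN) : W22_kind G ->
  exp_poly lam (fun k => tmap (act (W22_gen K (G k)) : M -> M) (idfun : N -> N) u).
Proof.
move=> kG; elim/tensor_ind: u => [|c u v hu hv|f n].
- by apply: exp_poly_ext (exp_poly0 _ lam) => k; rewrite tmap0.
- by apply: exp_poly_ext (exp_polyP c hu hv) => k; rewrite tmapP.
pose F := mklinear (pure_tensor_linearl n : linear ((@pure_tensor K M N)^~ n)).
apply: exp_poly_ext (exp_poly_linear F (exp_poly_Psi beta h lam_neq0 f kG)) => k.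
rewrite tmaplE; congr (pure_tensor _ n); symmetry; exact: Psi_actE.
Qed.

Lemma tame_Psi_tensor : tame (fun z => z = lam \/ Lam z) MN.
Proof.
move=> G u kG; have [d hd] := tame_left u kG.
have [q [rq hq]] := tame_right u kG.
exists (('X - lam%:P) ^+ d * q); split=> [z|].
  rewrite rootM => /orP[|/rq]; last by right.
  case: d {hd} => [|d]; last by rewrite root_exp_XsubC => /eqP ->; left.
  by rewrite (negbTE (root1 _)).
have hl : ev_recur (('X - lam%:P) ^+ d)
  (fun k => tmap (act (W22_gen K (G k)) : M -> M) (idfun : N -> N) u).
  by exists 0 => k _; exact: hd.
apply: ev_recur_ext (ev_recurD (ev_recurMr q hl) (ev_recurMl _ hq)) => k.
by rewrite act_tensor.
Qed.

Lemma irreducible_Psi_tensor :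
  alpha <> 0 -> ~ Lam lam -> irreducible N -> irreducible MN.
Proof.
move=> /eqP alpha0 lamN [[n0 n0_neq0] irrN]; split.
  exists (pure_tensor (polyts1 K : M) n0).
  exact: (pure_tensor_neq0 (phi := mklinear (@coef00_linear K)) (coef00_1 K)).
move=> S [S0 SD SZ Sact].
have SP c u v : S u -> S v -> S (c *: u + v) by move=> Su Sv; apply: SD => //; exact: SZ.
have [[u Su u0]|none] := pselect (exists2 u, S u & u <> 0); last first.
  by left=> v Sv; apply: contrapT => v0; apply: none; exists v.
right.
have stab a : stabilizes S (Psi_act_gen lam beta h a).
  have [G kG [k ->]] := W22_kindP a.
  exists (mklinear (@act_linearr _ _ M (W22_gen K (G k)))); split=> [f|v Sv].
    exact: Psi_actE.
  have [d hd] := tame_left v kG.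
  have [q [rq hq]] := tame_right v kG.
  apply: (recur_split S0 SP _ lam_neq0 _ hd hq) => [i|].
    by rewrite -act_tensor; exact: Sact.
  by apply/negP => /rq.
have [n n_neq0 Sn] := psi_tensor_line lam_neq0 alpha0 SP stab (ex_intro2 _ _ u Su u0).
pose T (n : N) := forall f : M, S (pure_tensor f n).
have Tsub : is_submodule T.
  split=> [f|x y Tx Ty f|c x Tx f|x y Ty f].
  - by rewrite pure_tensor0r.
  - by rewrite pure_tensorDr; apply: SD.
  - by rewrite pure_tensorZr; apply: SZ.
  have := SP (-1) _ _ (Ty (act x f)) (Sact x _ (Ty f)).
  by rewrite act_pure_tensor scaleN1r addKr.
have [Tz|Tall] := irrN T Tsub; first by case: n_neq0; exact: Tz.
elim/tensor_ind=> [|c x y Sx Sy|f y]; [exact: S0 | exact: SP | exact: Tall].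
Qed.

End PsiTensor.

(** * Reducible tensor products *)

Section TensorSubmodules.
Variables (K : fieldType) (g : lieAlgType K).
Implicit Types M N : lieModule g.

Lemma tensor_neq0_right M N (u : tensor_module M N) : u <> 0 -> exists n : N, n <> 0.
Proof.
move=> u0; apply: contrapT => none; apply: u0.
have n0 (n : N) : n = 0 by apply: contrapT => n0; apply: none; exists n.
elim/tensor_ind: u => [//|c x y -> ->|v w]; first by rewrite scaler0 addr0.
by rewrite (n0 w) pure_tensor0r.
Qed.

Lemma contract_act M N (phi : {linear M -> K^o}) x (u : tensor_module M N) :
  contract phi (act x u) =
  contract (mklinear (linearP (phi \o act x) : linear (phi \o act x))) u
  + act x (contract phi u).
Proof.
rewrite act_tensor; move: u; apply: tensor_ext => [c u v|c u v|v w].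
- by rewrite !tmapP addrACA -scalerDr contractP.
- by rewrite !contractP act_linearr addrACA -scalerDr.
rewrite tmaplE tmaprE; set psi := mklinear _.
have -> (a b : tensor_space M N) : contract phi (a + b) = contract phi a + contract phi b.
  by have := contractP phi 1 a b; rewrite !scale1r.
by rewrite !contractE [act x (_ *: w)]linearZ.
Qed.

(* For a submodule S of N, the tensors all of whose contractions lie in S form
   a submodule, because contractions intertwine up to another contraction. *)
Lemma irreducible_tensor_right M N (phi : {linear M -> K^o}) e :
  phi e = 1 -> irreducible (tensor_module M N) -> irreducible N.
Proof.
move=> phie [[u0 u0_neq0] irr]; split; first exact: tensor_neq0_right u0_neq0.
move=> S [S0 SD SZ Sact].
have SP c u v : S u -> S v -> S (c *: u + v) by move=> Su Sv; apply: SD => //; exact: SZ.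
pose T (u : tensor_module M N) := forall psi : {linear M -> K^o}, S (contract psi u).
have Tsub : is_submodule T.
  split=> [psi|u v Tu Tv psi|c u Tu psi|x u Tu psi].
  - by rewrite linear0.
  - by rewrite linearD; exact: SD (Tu psi) (Tv psi).
  - by rewrite linearZ; exact: SZ (Tu psi).
  by rewrite contract_act; apply: SD => //; exact: Sact.
have [Tz|Tall] := irr T Tsub; [left=> n Sn | right=> n].
  apply: contrapT => n0; apply: (pure_tensor_neq0 phie n0); apply: Tz => psi.
  by rewrite contractE; exact: SZ.
by have := Tall (pure_tensor e n) phi; rewrite contractE phie scale1r.
Qed.

End TensorSubmodules.

Lemma gen_submodule (K : numFieldType) (M : lieModule (W22 K)) (S : M -> Prop) :
  S 0 -> (forall c u v, S u -> S v -> S (c *: u + v)) ->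
  (forall a v, S v -> S (act (W22_gen K a) v)) -> is_submodule S.
Proof.
move=> S0 SP Sgen; split=> // [u v Su Sv|c v Sv|x v Sv].
- by rewrite -[u]scale1r; exact: SP.
- by rewrite -[_ *: _]addr0; exact: SP.
elim/W22_ind: x => [|c x y hx hy|a]; [by rewrite act0v| |exact: Sgen].
by rewrite act_linearl; exact: SP.
Qed.

Lemma tensor_kernel_submodule (K : numFieldType) (M N : lieModule (W22 K))
    (E : {linear M -> M}) :
  (forall a f, E (act (W22_gen K a) f) = E (act (W22_gen K a) (E f))) ->
  is_submodule (fun u : tensor_module M N => tmap E idfun u = 0).
Proof.
move=> EE; apply: gen_submodule => [|c u v Su Sv|a u Su].
- exact: tmap0.
- by rewrite tmapP Su Sv scaler0 addr0.
rewrite act_tensor tmapDr -tmaprl_comm Su tmap0 addr0 tmapl_comp.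
have e : E \o act (W22_gen K a) =1 (E \o act (W22_gen K a)) \o E by exact: EE.
by rewrite (eq_tmap e (fun=> erefl)) -tmapl_comp Su tmap0.
Qed.

Definition W22_index (a : W22_basis) : int :=
  match a with L_ k => k | W_ k => k | H_ k => k end.

Definition shift_coef (K : numFieldType) (lam : K) (n : int) (a : W22_basis) : K :=
  if a is L_ k then n%:~R * lam ^ k else 0.

(* On Psi the shifts in s satisfy this; a second such family on the same module
   with the same [lam] yields the submodule where both families agree. *)
Definition shift_like (K : numFieldType) (lam : K) (M : lieModule (W22 K))
    (sg : int -> {linear M -> M}) : Prop :=
  forall n a u, sg n (act (W22_gen K a) u) =
    act (W22_gen K a) (sg n u) - shift_coef lam n a *: sg (W22_index a + n) u.

Lemma shift_like_agree (K : numFieldType) (lam : K) (M : lieModule (W22 K))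
    (sg tau : int -> {linear M -> M}) v :
  irreducible M -> shift_like lam sg -> shift_like lam tau ->
  v <> 0 -> (forall n, sg n v = tau n v) -> forall n u, sg n u = tau n u.
Proof.
move=> [_ irr] hs ht v0 hv n u; pose S u := forall n, sg n u = tau n u.
have /irr[Sz|Sall] : is_submodule S; last exact: Sall.
  apply: gen_submodule => [k|c x y Sx Sy k|a x Sx k].
  - by rewrite !linear0.
  - by rewrite !linearP Sx Sy.
  by rewrite hs ht !Sx.
by case: v0; apply: Sz.
Qed.

Definition has_shift (K : numFieldType) (lam : K) (M : lieModule (W22 K)) : Prop :=
  exists2 sg : int -> {linear M -> M}, shift_like lam sg &
    exists2 v, v <> 0 & forall n, sg n v = v.

Section ShiftTensor.
Variables (K : numFieldType) (lam : K) (M N : lieModule (W22 K)).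
Local Notation MN := (tensor_module M N).

Definition tensor_shiftl (sg : int -> {linear M -> M}) (n : int) : {linear MN -> MN} :=
  mklinear (tmap_is_linear (sg n) (idfun : N -> N)).

Definition tensor_shiftr (sg : int -> {linear N -> N}) (n : int) : {linear MN -> MN} :=
  mklinear (tmap_is_linear (idfun : M -> M) (sg n)).

Lemma shift_like_left sg : shift_like lam sg -> shift_like lam (tensor_shiftl sg).
Proof.
move=> hs n a u; rewrite !act_tensor /=; move: u.
set c := shift_coef _ _ _; set k := W22_index a + n.
apply: tensor_ext => [d u v|d u v|v w].
- by rewrite !tmapP addrACA -scalerDr tmapP.
- rewrite !tmapP addrACA -scalerDr [c *: (_ + _)]scalerDr opprD addrACA.
  by rewrite scalerBr !scalerA [d * c]mulrC.
rewrite !(tmaplE, tmaprE, tmapDr).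
by rewrite hs pure_tensorBl pure_tensorZl addrAC.
Qed.

Lemma shift_like_right sg : shift_like lam sg -> shift_like lam (tensor_shiftr sg).
Proof.
move=> hs n a u; rewrite !act_tensor /=; move: u.
set c := shift_coef _ _ _; set k := W22_index a + n.
apply: tensor_ext => [d u v|d u v|v w].
- by rewrite !tmapP addrACA -scalerDr tmapP.
- rewrite !tmapP addrACA -scalerDr [c *: (_ + _)]scalerDr opprD addrACA.
  by rewrite scalerBr !scalerA [d * c]mulrC.
rewrite !(tmaplE, tmaprE, tmapDr).
by rewrite hs pure_tensorBr pure_tensorZr addrA.
Qed.

Lemma has_shift_right (phi : {linear M -> K^o}) e : phi e = 1 ->
  has_shift lam N -> has_shift lam MN.
Proof.
move=> phie [sg hs [v v0 hv]]; exists (tensor_shiftr sg).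
  exact: shift_like_right.
exists (pure_tensor e v); first exact: pure_tensor_neq0 phie v0.
by move=> n; rewrite -[RHS](congr1 (pure_tensor e) (hv n)); exact: tmaprE.
Qed.

Lemma has_shift_left (phi : {linear M -> K^o}) (sg : int -> {linear M -> M}) e n0 :
  phi e = 1 -> (forall n, sg n e = e) -> shift_like lam sg -> n0 <> 0 :> N ->
  has_shift lam MN.
Proof.
move=> phie sge hs n0_neq0; exists (tensor_shiftl sg).
  exact: shift_like_left.
exists (pure_tensor e n0); first exact: pure_tensor_neq0 phie n0_neq0.
by move=> n; rewrite -[RHS](congr1 ((@pure_tensor K M N)^~ n0) (sge n)); exact: tmaplE.
Qed.

Lemma shift_tensor_reducible (phi : {linear M -> K^o}) (sg : int -> {linear M -> M}) e f :
  phi e = 1 -> (forall n, sg n e = e) -> shift_like lam sg -> sg 1 f = f + e ->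
  has_shift lam N -> ~ irreducible MN.
Proof.
move=> phie sge hs sgf [tau ht [v v0 tauv]] irr.
have agree n :
    tensor_shiftl sg n (pure_tensor e v : MN) = tensor_shiftr tau n (pure_tensor e v : MN).
  by rewrite /= tmaplE tmaprE sge tauv.
have := shift_like_agree irr (shift_like_left hs) (shift_like_right ht)
  (pure_tensor_neq0 phie v0) agree 1 (pure_tensor f v : MN).
rewrite /= tmaplE tmaprE sgf tauv pure_tensorDl => h.
by apply: (pure_tensor_neq0 phie v0); apply: (addrI (pure_tensor f v)); rewrite addr0.
Qed.

End ShiftTensor.

Section EvalT0.
Variable K : numFieldType.
Local Notation Kts := {poly {poly K}}.
Local Notation cst c := (c%:P%:P : Kts).

Lemma eval_t0M (f g : Kts) : eval_t0 (f * g) = eval_t0 f * eval_t0 g.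
Proof.
apply/polyP => i; rewrite eval_t0E !coefM coef_sum (raddf_sum (@polyC K)).
by apply: eq_bigr => j _; rewrite /= !eval_t0E coef0M polyCM.
Qed.

Lemma eval_t0C (p : {poly K}) : eval_t0 p%:P = cst p`_0.
Proof. by apply/polyP => i; rewrite eval_t0E !coefC; case: eqP; rewrite ?coef0. Qed.

Lemma eval_t0X : eval_t0 ('X : Kts) = 'X.
Proof.
by apply/polyP => i; rewrite eval_t0E coefX; case: eqP => _; rewrite ?coef1 ?coef0.
Qed.

Lemma eval_t0N (f : Kts) : eval_t0 (- f) = - eval_t0 f.
Proof. by apply/polyP => i; rewrite coefN !eval_t0E !coefN polyCN. Qed.

Lemma eval_t0K (f : Kts) : eval_t0 (eval_t0 f) = eval_t0 f.
Proof. by apply/polyP => i; rewrite !eval_t0E coefC. Qed.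

Lemma eval_t0_shift m (f : Kts) : eval_t0 (shift_s m f) = shift_s m (eval_t0 f).
Proof.
elim/poly_ind: f => [|f c IH].
  by rewrite -polyC0 shift_sC eval_t0C coef0 shift_sC.
rewrite !(shift_sD, shift_sM, eval_t0D, eval_t0M, shift_sC, eval_t0C, shift_sX, eval_t0X).
by rewrite IH -(rmorph_int (@polyC K)) !coefC.
Qed.

(* For alpha = 0 every generator preserves the multiples of t. *)
Lemma eval_t0_Psi (lam alpha beta : K) (h : Talpha alpha) a (f : polyts K) :
  alpha = 0 -> eval_t0 (Psi_act_gen lam beta h a f) =
  eval_t0 (Psi_act_gen lam beta h a (eval_t0 f)).
Proof.
move=> alpha0; subst alpha.
have Es m (p F : Kts) :
    eval_t0 (p * shift_s m F) = eval_t0 (p * shift_s m (eval_t0 F)).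
  by rewrite !eval_t0M !eval_t0_shift eval_t0K.
have Et (p F G : Kts) :
    eval_t0 (p * ('X : {poly K})%:P * F) = eval_t0 (p * ('X : {poly K})%:P * G).
  by rewrite !eval_t0M eval_t0C coefX !polyC0 mulr0 !mul0r.
have EB (p q : Kts) : eval_t0 (- p - q) = - eval_t0 p - eval_t0 q.
  by rewrite eval_t0D !eval_t0N.
case: a => m /=; rewrite ?mulr0 ?addr0 /=.
- rewrite [LHS]EB [RHS]EB.
  exact: (congr2 (fun x y => - x - y) (Es m _ f) (Et _ _ _)).
- exact: Et.
exact: Es.
Qed.

End EvalT0.

Section PsiModule.
Variables (K : numFieldType) (lam alpha beta : K) (h : Talpha alpha).
Hypothesis lam_neq0 : lam != 0.
Local Notation Kts := {poly {poly K}}.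
Local Notation cst c := (c%:P%:P : Kts).
Local Notation t := (('X : {poly K})%:P : Kts).
Local Notation M := (Psi lam alpha beta h lam_neq0).

Definition Psi_coef00 : {linear M -> K^o} := mklinear (@coef00_linear K).

Lemma Psi_coef00_1 : Psi_coef00 (polyts1 K) = 1.
Proof. exact: coef00_1. Qed.

Lemma coef10_linear : linear (fun f : polyts K => (f : Kts)`_0`_1 : K^o).
Proof. by move=> c f g; rewrite !coefD coef_polyts_scale coefZ. Qed.

Definition Psi_shift (n : int) : {linear M -> M} := mklinear (@shift_s_linear K n).

Lemma Psi_shift1 n : Psi_shift n (polyts1 K) = polyts1 K.
Proof. by rewrite /= /polyts1 -polyC1 shift_sC. Qed.

Lemma Psi_shiftX : Psi_shift 1 ('X : Kts) = (('X : Kts) : M) + (polyts1 K : M).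
Proof. exact: shift_sX. Qed.

Lemma Psi_shift_like : shift_like lam Psi_shift.
Proof.
move=> n a f; rewrite !Psi_actE /=.
have scE (c : K) (f1 : Kts) : (c *: (f1 : M) : M) = cst c * f1 :> Kts by exact: polyts_scaleE.
rewrite scE; move: f => f.
have sN m (u : Kts) : shift_s m (- u) = - shift_s m u by exact: raddfN.
have nE (m : int) : (m%:~R%:P : Kts) = cst m%:~R by rewrite -(rmorph_int (@polyC K)).
case: a => k /=.
all: rewrite ?deriv_t_shift_s !(sN, shift_sM, shift_sD, shift_sX, shift_sC).
all: rewrite ?shift_s_shift_s [n + k]addrC ?nE ?polyCM.
- by set F := shift_s (k + n) f; set F1 := shift_s (k + n) _; ring.
- by rewrite !polyC0 mul0r subr0.
by rewrite !polyC0 mul0r subr0.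
Qed.

Lemma Psi_tensor_alpha (N : lieModule (W22 K)) :
  irreducible (tensor_module M N) -> alpha <> 0.
Proof.
move=> irr a0; have [[u0 u0_neq0] irr'] := irr.
have [n n0] := tensor_neq0_right u0_neq0.
pose E0 : {linear M -> M} := mklinear (@eval_t0_linear K).
have e a f : E0 (act (W22_gen K a) f) = E0 (act (W22_gen K a) (E0 f)).
  have E1 (x : M) : E0 (act (W22_gen K a) x) = eval_t0 (Psi_act_gen lam beta h a x).
    exact: (congr1 (@eval_t0 K) (Psi_actE a x)).
  by rewrite [LHS]E1 [RHS]E1; exact: eval_t0_Psi.
have := tensor_kernel_submodule N e.
move/irr' => [Sz|Sall].
  apply: (@pure_tensor_neq0 _ _ _
    (mklinear coef10_linear : {linear M -> K^o}) (t : M) n) => //.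
    by rewrite /= coefC coefX.
  apply: Sz; rewrite tmaplE /= eval_t0C coefX !polyC0; exact: pure_tensor0l.
apply: (pure_tensor_neq0 Psi_coef00_1 n0).
rewrite -[RHS](Sall (pure_tensor (polyts1 K : M) n)) tmaplE; congr (pure_tensor _ n).
by rewrite /= /polyts1 -polyC1 eval_t0C coefC.
Qed.

End PsiModule.

Section TensorUnit.
Variables (K : fieldType) (V : lmodType K).

Definition tensor_unit : tensor_space V K^o -> V :=
  tensor_lift (fun (v : V) (c : K^o) => c *: v).

Let Bl (c : K^o) : linear (fun v : V => c *: v).
Proof. by move=> a v w; rewrite scalerDr !scalerA mulrC. Qed.

Let Br (v : V) : linear (fun c : K^o => c *: v).
Proof. by move=> a c d; rewrite scalerDl scalerA. Qed.

Lemma tensor_unitP c (u v : tensor_space V K^o) :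
  tensor_unit (c *: u + v) = c *: tensor_unit u + tensor_unit v.
Proof. exact: (tensor_lift_linear Bl Br). Qed.

Lemma tensor_unitE v (c : K^o) : tensor_unit (pure_tensor v c) = c *: v.
Proof. exact: (tensor_liftE Bl Br). Qed.

Lemma tensor_unit0 : tensor_unit 0 = 0.
Proof.
by have := tensor_unitP (-1) 0 0; rewrite scaler0 addr0 scaleN1r addNr.
Qed.

Lemma tensor_unit_tmap (D : {linear V -> V}) u :
  tensor_unit (tmap D idfun u) = D (tensor_unit u).
Proof.
move: u; apply: tensor_ext => [c u v|c u v|v c].
- by rewrite tmapP tensor_unitP.
- by rewrite tensor_unitP linearP.
by rewrite tmaplE !tensor_unitE linearZ.
Qed.

End TensorUnit.

Section PsiIrreducible.
Variables (K : numFieldType) (lam alpha beta : K) (h : Talpha alpha).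
Hypothesis lam_neq0 : lam != 0.
Local Notation Kts := {poly {poly K}}.
Local Notation t := (('X : {poly K})%:P : Kts).
Local Notation M := (Psi lam alpha beta h lam_neq0).

Lemma irreducible_Psi : alpha <> 0 -> irreducible M.
Proof.
move=> /eqP alpha0; split.
  exists (polyts1 K) => e; have := coef00_1 K; rewrite [polyts1 K]e !coef0.
  by move/eqP; rewrite eq_sym oner_eq0.
move=> S [S0 SD SZ Sact].
have [[f Sf f0]|none] := pselect (exists2 f, S f & f <> 0); last first.
  by left=> v Sv; apply: contrapT => v0; apply: none; exists v.
right; pose S' u := S (tensor_unit u).
have SP c u v : S' u -> S' v -> S' (c *: u + v).
  by move=> Su Sv; rewrite /S' tensor_unitP; apply: SD => //; exact: SZ.
have stab a : stabilizes S' (Psi_act_gen lam beta h a).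
  exists (mklinear (@act_linearr _ _ M (W22_gen K a))); split=> [g|u Su].
    exact: Psi_actE.
  by rewrite /S' tensor_unit_tmap; exact: Sact.
have [|n n0 Sn] := psi_tensor_line lam_neq0 alpha0 SP stab.
  exists (pure_tensor (f : polyts K) (1 : K^o)).
    by rewrite /S' tensor_unitE scale1r.
  move=> e; apply: f0; rewrite -[f]scale1r -(tensor_unitE f 1) e.
  exact: tensor_unit0.
move=> g; have := SZ n^-1 _ (Sn g).
by rewrite tensor_unitE scalerA mulVf ?scale1r //; exact/eqP.
Qed.

Lemma irreducible_Psi_alpha : irreducible M -> alpha <> 0.
Proof.
move=> [_ irr] a0; pose S (f : M) := eval_t0 f = 0.
have /irr[Sz|Sall] : is_submodule S.
  apply: gen_submodule => [|c f g Sf Sg|a f Sf].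
  - exact: (linear0 (mklinear (@eval_t0_linear K))).
  - have := eval_t0_linear c (f : polyts K) g; rewrite /S => ->.
    by rewrite Sf Sg scaler0 addr0.
  rewrite /S [act _ f]Psi_actE eval_t0_Psi // Sf.
  have := Psi_act_gen_linear lam beta h a (-1) 0 0.
  rewrite scaler0 addr0 scaleN1r addNr => ->.
  exact: (linear0 (mklinear (@eval_t0_linear K))).
- have := Sz (t : M); rewrite /S eval_t0C coefX => /(_ erefl) e.
  have := congr1 (fun f : Kts => f`_0`_1) e.
  by rewrite /= coefC coefX !coef0 => /eqP; rewrite oner_eq0.
have := Sall (polyts1 K); rewrite /S /polyts1 -polyC1 eval_t0C coefC /= => e.
have := congr1 (fun f : Kts => f`_0`_0) e.
by rewrite /= !coefC ?coef0 => /eqP; rewrite oner_eq0.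
Qed.

End PsiIrreducible.

Section PsiIso.
Variable K : numFieldType.
Local Notation Kts := {poly {poly K}}.
Local Notation cst c := (c%:P%:P : Kts).
Local Notation t := (('X : {poly K})%:P : Kts).
Variables (lam1 lam2 alpha1 alpha2 beta1 beta2 : K).
Variables (h : Talpha alpha1) (g : Talpha alpha2).
Hypotheses (lam1_neq0 : lam1 != 0) (lam2_neq0 : lam2 != 0).
Local Notation M1 := (Psi lam1 alpha1 beta1 h lam1_neq0).
Local Notation M2 := (Psi lam2 alpha2 beta2 g lam2_neq0).

Lemma Psi_act_gen1 lam alpha beta (k : Talpha alpha) a :
  Psi_act_gen lam beta k a (polyts1 K) =
  match a with
  | L_ m => - (cst (lam ^ m) * ('X - (k m \Po - 'X)%:P))
  | W_ m => cst (lam ^ m) * (t + cst (m%:~R * alpha))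
  | H_ m => cst (lam ^ m * beta)
  end.
Proof.
have s1 m : shift_s m (polyts1 K) = 1 by rewrite /polyts1 -polyC1 shift_sC.
case: a => m /=; rewrite s1 ?mulr1 // -polyC1 deriv_tC derivC polyC0.
by rewrite mulr0 subr0.
Qed.

(* L_0 and W_0 act by -s and t, so an isomorphism is multiplication by the image
   of 1, which must then be a unit, i.e. a constant. *)
Lemma Psi_iso_act : lie_iso M1 M2 ->
  forall a, Psi_act_gen lam1 beta1 h a (polyts1 K) = Psi_act_gen lam2 beta2 g a (polyts1 K).
Proof.
move=> [phi [[psi phiK psiK] eqv]].
have phia a (f : polyts K) :
    phi (Psi_act_gen lam1 beta1 h a f) = Psi_act_gen lam2 beta2 g a (phi f).
  have := eqv (W22_gen K a) f.
  have -> : act (W22_gen K a) (f : M1) = Psi_act_gen lam1 beta1 h a f by exact: Psi_actE.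
  by move=> ->; exact: Psi_actE.
pose F (f : Kts) : Kts := phi f.
have FD p q : F (p + q) = F p + F q by exact: linearD.
have FC c p : F (cst c * p) = cst c * F p.
  have -> : cst c * p = (c *: (p : polyts K) : polyts K) by rewrite polyts_scaleE.
  rewrite -(polyts_scaleE c (F p)); exact: (linearZ_LR phi c p).
have Ft f : F (t * f) = t * F f by have := phia (W_ 0) f; rewrite !Psi_act_W0.
have Fs f : F ('X * f) = 'X * F f.
  have := phia (L_ 0) f; rewrite !Psi_act_L0 => e; apply: oppr_inj.
  by rewrite -[RHS]e; symmetry; exact: linearN.
have F0 : F 0 = 0 by exact: linear0.
have Fp (p : {poly K}) f : F (p%:P * f) = p%:P * F f.
  elim/poly_ind: p => [|p c IH]; first by rewrite polyC0 !mul0r F0.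
  by rewrite polyCD polyCM !mulrDl FD FC [p%:P * t]mulrC -!mulrA Ft IH.
have FE (f : Kts) : F f = f * F 1.
  elim/poly_ind: f => [|f c IH]; first by rewrite F0 mul0r.
  rewrite FD mulrDl; congr (_ + _); last by rewrite -[c%:P]mulr1 Fp mulr1.
  by rewrite [f * 'X]mulrC Fs IH mulrA.
have [c c0 Fc] : exists2 c : K, c != 0 & F 1 = cst c.
  have u : F 1 \is a GRing.unit.
    apply/unitrPr; exists (psi (1 : Kts)); rewrite mulrC -FE; exact: psiK.
  move: u; rewrite poly_unitE => /andP[/eqP s1]; rewrite poly_unitE => /andP[/eqP s2].
  rewrite unitfE => c0; exists ((F 1)`_0)`_0 => //.
  by rewrite [LHS]size1_polyC ?s1 // [(F 1)`_0]size1_polyC ?s2 // !coefC.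
move=> a; have := phia a (polyts1 K).
have -> : phi (polyts1 K) = c *: polyts1 K :> polyts K.
  by rewrite polyts_scaleE mulr1; exact: Fc.
have -> : Psi_act_gen lam2 beta2 g a (c *: polyts1 K) =
    c *: Psi_act_gen lam2 beta2 g a (polyts1 K).
  exact: (linearZ_LR (mklinear (Psi_act_gen_linear lam2 beta2 g a)) c (polyts1 K)).
rewrite polyts_scaleE => e.
have := etrans (esym (FE (Psi_act_gen lam1 beta1 h a (polyts1 K)))) e.
by rewrite Fc mulrC; apply: mulfI; rewrite !polyC_eq0.
Qed.

Lemma Psi_isoP : lie_iso M1 M2 <->
  [/\ lam1 = lam2, alpha1 = alpha2, beta1 = beta2 & forall m : int, h m = g m].
Proof.
split=> [/Psi_iso_act act_eq|].
  have coefW m i : (lam1 ^ m *: ('X + (m%:~R * alpha1)%:P))`_i =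
      (lam2 ^ m *: ('X + (m%:~R * alpha2)%:P))`_i.
    have := act_eq (W_ m); rewrite !Psi_act_gen1 -!polyCD -!polyCM => /polyC_inj.
    by rewrite !mul_polyC => ->.
  have elam : lam1 = lam2.
    by have := coefW 1 1%N; rewrite !coefZ !coefD !coefX !coefC !addr0 !mulr1 !expr1z.
  have ealpha : alpha1 = alpha2.
    have := coefW 1 0%N; rewrite !coefZ !coefD !coefX !coefC !add0r !mul1r !expr1z.
    by rewrite elam; apply: mulfI.
  have ebeta : beta1 = beta2.
    have := act_eq (H_ 0); rewrite !Psi_act_gen1 !expr0z !mul1r.
    by move=> /polyC_inj /polyC_inj.
  split=> // m; have := act_eq (L_ m); rewrite !Psi_act_gen1 elam => /oppr_inj.
  have l0 : cst (lam2 ^ m) != 0 by rewrite !polyC_eq0 expfz_neq0.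
  move/(mulfI l0)/addrI/oppr_inj/polyC_inj/(congr1 (fun p : {poly K} => p \Po - 'X)).
  have NX : (- 'X) \Po (- 'X) = 'X :> {poly K}.
    by rewrite -[A in A \Po _]scaleN1r comp_polyZ comp_polyX scaleN1r opprK.
  by rewrite -!comp_polyA NX !comp_polyXr.
move=> [elam ealpha ebeta hg].
have act_eq x (f : polyts K) : act x (f : M1) = act x (f : M2) :> polyts K.
  elim/W22_ind: x => [|c x y hx hy|a].
  - by rewrite (act0v (f : M1)) (act0v (f : M2)).
  - by rewrite [LHS](act_linearl (f : M1)) [RHS](act_linearl (f : M2)) hx hy.
  rewrite [LHS]Psi_actE [RHS]Psi_actE.
  by case: a => m /=; rewrite ?hg ?elam ?ealpha ?ebeta.
have idl : linear (fun f : M1 => f : M2) by [].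
exists (mklinear idl); split; first by exists (fun f : M2 => f : M1).
exact: act_eq.
Qed.

End PsiIso.

Section TensorFamily.
Variable K : numFieldType.
Implicit Type V : lieModule (W22 K).

Lemma tensor_family_recl m (M : 'I_m.+1 -> lieModule (W22 K)) V :
  tensor_family M V =
  tensor_module (M ord0) (tensor_family (fun i => M (lift ord0 i)) V).
Proof. exact: big_ord_recl. Qed.

Lemma tensor_family0 (M : 'I_0 -> lieModule (W22 K)) V : tensor_family M V = V.
Proof. exact: big_ord0. Qed.

Local Notation Psi_family lam alpha beta h lam_neq0 :=
  (fun i => Psi (lam i) (alpha i) (beta i) (h i) (lam_neq0 i)).

Lemma tensor_family_irreducible m (lam alpha beta : 'I_m -> K)
    (h : forall i, Talpha (alpha i)) (lam_neq0 : forall i, lam i != 0) V :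
  restricted V -> (forall i j, i != j -> lam i <> lam j) ->
  (forall i, alpha i <> 0) -> irreducible V ->
  tame (fun z => exists i, z = lam i)
    (tensor_family (Psi_family lam alpha beta h lam_neq0) V) /\
  irreducible (tensor_family (Psi_family lam alpha beta h lam_neq0) V).
Proof.
move=> rV; elim: m lam alpha beta h lam_neq0 => [|m IH]
  lam alpha beta h lam_neq0 lamI alpha0 irrV.
  by rewrite tensor_family0; split=> //; exact: restricted_tame.
have lamI' (i j : 'I_m) : i != j -> lam (lift ord0 i) <> lam (lift ord0 j).
  by move=> ij; apply: lamI; rewrite (inj_eq lift_inj).
have [tN irrN] := IH _ _ (fun i => beta (lift ord0 i)) (fun i => h (lift ord0 i))
  (fun i => lam_neq0 (lift ord0 i)) lamI' (fun i => alpha0 (lift ord0 i)) irrV.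
rewrite tensor_family_recl; split.
  have tMN := @tame_Psi_tensor _ _ _ (beta ord0) (h ord0) (lam_neq0 ord0) _ _ tN.
  by apply: (sub_tame _ tMN) => z [->|[i ->]];
    [exists ord0 | exists (lift ord0 i)].
apply: (@irreducible_Psi_tensor _ _ _ (beta ord0) (h ord0) (lam_neq0 ord0) _ _ tN) => //.
by case=> i; apply: lamI; exact: neq_lift.
Qed.

Lemma tensor_family_has_shift m (lam alpha beta : 'I_m -> K)
    (h : forall i, Talpha (alpha i)) (lam_neq0 : forall i, lam i != 0) V v :
  v <> 0 :> V ->
  (exists u : tensor_family (Psi_family lam alpha beta h lam_neq0) V, u <> 0) /\
  forall i, has_shift (lam i) (tensor_family (Psi_family lam alpha beta h lam_neq0) V).
Proof.
move=> v0; elim: m lam alpha beta h lam_neq0 => [|m IH] lam alpha beta h lam_neq0.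
  by rewrite tensor_family0; split; [exists v | case].
have [[u u0] hs] := IH _ _ (fun i => beta (lift ord0 i))
  (fun i => h (lift ord0 i)) (fun i => lam_neq0 (lift ord0 i)).
rewrite tensor_family_recl; split.
  by exists (pure_tensor (polyts1 K : Psi _ _ _ (h ord0) (lam_neq0 ord0)) u);
    exact: (pure_tensor_neq0 (Psi_coef00_1 (beta ord0) (h ord0) (lam_neq0 ord0))).
move=> i; case: (unliftP ord0 i) => [j ->|->].
  exact: (has_shift_right (Psi_coef00_1 (beta ord0) (h ord0) (lam_neq0 ord0))).
exact: (has_shift_left (Psi_coef00_1 (beta ord0) (h ord0) (lam_neq0 ord0))
    (Psi_shift1 (beta ord0) (h ord0) (lam_neq0 ord0))
    (@Psi_shift_like _ _ _ (beta ord0) (h ord0) (lam_neq0 ord0)) u0).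
Qed.

Lemma tensor_family_irreducible_inv m (lam alpha beta : 'I_m -> K)
    (h : forall i, Talpha (alpha i)) (lam_neq0 : forall i, lam i != 0) V :
  irreducible (tensor_family (Psi_family lam alpha beta h lam_neq0) V) ->
  [/\ forall i j, i != j -> lam i <> lam j, forall i, alpha i <> 0 & irreducible V].
Proof.
elim: m lam alpha beta h lam_neq0 => [|m IH] lam alpha beta h lam_neq0.
  by rewrite tensor_family0 => irrV; split=> //; case.
rewrite tensor_family_recl => irr.
have irrN := irreducible_tensor_right (Psi_coef00_1 (beta ord0) (h ord0) (lam_neq0 ord0)) irr.
have [lamI alpha0 irrV] := IH _ _ (fun i => beta (lift ord0 i))
  (fun i => h (lift ord0 i)) _ irrN.
have lam0 j : lam ord0 <> lam (lift ord0 j).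
  move=> e; have [[v v0] _] := irrV.
  have [_ /(_ j) hs] := tensor_family_has_shift
    (fun i => beta (lift ord0 i)) (fun i => h (lift ord0 i))
    (fun i => lam_neq0 (lift ord0 i)) v0.
  move: hs; rewrite -e => hs.
  exact: (shift_tensor_reducible (Psi_coef00_1 (beta ord0) (h ord0) (lam_neq0 ord0))
    (Psi_shift1 (beta ord0) (h ord0) (lam_neq0 ord0))
    (@Psi_shift_like _ _ _ (beta ord0) (h ord0) (lam_neq0 ord0))
    (Psi_shiftX (beta ord0) (h ord0) (lam_neq0 ord0)) hs irr).
split=> // [i j|i].
  case: (unliftP ord0 i) => [i' ->|->]; case: (unliftP ord0 j) => [j' ->|->].
  - by rewrite (inj_eq lift_inj); exact: lamI.
  - by move=> _ /esym; exact: lam0.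
  - by move=> _; exact: lam0.
  - by rewrite eqxx.
case: (unliftP ord0 i) => [i' ->|->]; first exact: alpha0.
exact: Psi_tensor_alpha irr.
Qed.

End TensorFamily.

Theorem theorem5p12 (R : realType) :
  (forall (lam1 lam2 alpha1 alpha2 beta1 beta1' : R[i])
     (h : Talpha alpha1) (g : Talpha alpha2)
     (lam1_neq0 : lam1 != 0) (lam2_neq0 : lam2 != 0),
     lie_iso (Psi lam1 alpha1 beta1 h lam1_neq0)
             (Psi lam2 alpha2 beta1' g lam2_neq0)
     <-> [/\ lam1 = lam2, alpha1 = alpha2, beta1 = beta1'
           & forall m : int, h m = g m])
  /\
  (forall (lam alpha beta1 : R[i]) (h : Talpha alpha) (lam_neq0 : lam != 0),
     irreducible (Psi lam alpha beta1 h lam_neq0) <-> alpha <> 0)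
  /\
  (forall (m : nat) (lam alpha beta1 : 'I_m -> R[i])
     (h : forall i, Talpha (alpha i)) (lam_neq0 : forall i, lam i != 0)
     (V : lieModule (W22 R[i])),
     (0 < m)%N -> restricted V ->
     irreducible (tensor_family
       (fun i => Psi (lam i) (alpha i) (beta1 i) (h i) (lam_neq0 i)) V)
     <-> [/\ forall i j, i != j -> lam i <> lam j,
             forall i, alpha i <> 0
           & irreducible V]).
Proof.
split; first by move=> *; exact: Psi_isoP.
split=> [lam alpha beta1 h lam_neq0|m lam alpha beta1 h lam_neq0 V _ rV].
  by split=> [/irreducible_Psi_alpha|]; last exact: irreducible_Psi.
split=> [/tensor_family_irreducible_inv //|[lamI alpha0 irrV]].
by have [] := tensor_family_irreducible beta1 h lam_neq0 rV lamI alpha0 irrV.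
Qed.
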